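(* Let $C$ be a coalgebra over a field $k$, let $\{S_i : i\in I\}$ be a complete set of representatives of the isomorphism types of simple right $C$-comodules, and for every $i\in I$ let $T_i:\mathcal{M}^C\to\mathcal{M}^C/\mathcal{T}_{E(S_i)}$ denote the localization functor. The following statements are equivalent: (i) $C$ is strictly quasi-finite as a right $C$-comodule; (ii) for every $i\in I$, $E(S_i)$ is strictly quasi-finite and $T_i(E(S_j))\neq 0$ only for finitely many $j\in I$; (iii) every quasi-finite right $C$-comodule is strictly quasi-finite; (iv) $T_i(C)$ is an artinian object for every $i\in I$.
   Context: $\mathcal{M}^C$ is the category of right $C$-comodules, $\mathrm{Com}_C(-,-)$ its Hom bifunctor, $E(S)$ the injective hull of $S$ in $\mathcal{M}^C$. For a simple right $C$-comodule $S$, $\mathcal{T}_{E(S)}$ is the localizing subcategory of all $M\in\mathcal{M}^C$ with $\mathrm{Com}_C(M,E(S))=0$. The quotient category $\mathcal{M}^C/\mathcal{T}$ by a localizing subcategory $\mathcal{T}$ is the abelian category determined up to equivalence by an exact functor $\mathcal{M}^C\to\mathcal{M}^C/\mathcal{T}$ (the localization functor) with kernel $\mathcal{T}$ and a right adjoint such that the counit of the adjunction is an isomorphism. A right $C$-comodule $M$ is quasi-finite if $\mathrm{Com}_C(S,M)$ is finite-dimensional over $k$ for every simple right $C$-comodule $S$, and strictly quasi-finite if $M/M'$ is quasi-finite for every subcomodule $M'$ of $M$. *)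

(* Defs.v *)
From HB Require Import structures.
From mathcomp Require Import all_boot all_algebra.
From mathcomp Require Import all_classical.
From mathcomp Require Import freeg.

Set Implicit Arguments.
Unset Strict Implicit.
Unset Printing Implicit Defensive.

Import GRing.Theory.
Local Open Scope ring_scope.
Local Open Scope quotient_scope.

Section QuotientModule.
Context (k : fieldType) (V : lmodType k) (U : submodClosed V).

Definition zmod_pred : {pred V} := fun v => v \in U.

Lemma zmod_pred_closed : zmod_closed zmod_pred.
Proof. exact: GRing.submod_closedB (submodClosedP U). Qed.

HB.instance Definition _ :=
  GRing.isZmodClosed.Build V zmod_pred zmod_pred_closed.

Definition quotmod : Type := Quotient.quot zmod_pred.

HB.instance Definition _ := GRing.Zmodule.on quotmod.
HB.instance Definition _ := Quotient.on quotmod.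

Definition quotmod_proj (v : V) : quotmod := \pi_quotmod v.

Lemma quotmod_projP (u v : V) :
  reflect (quotmod_proj u = quotmod_proj v) (u - v \in U).
Proof.
rewrite (Quotient.idealrBE zmod_pred) /quotmod_proj.
exact: eqP.
Qed.

Lemma quotmod_projK (q : quotmod) : quotmod_proj (repr q) = q.
Proof. exact: reprK. Qed.

Lemma quotmod_proj_is_zmod_morphism : zmod_morphism quotmod_proj.
Proof. exact: pi_is_zmod_morphism. Qed.

HB.instance Definition _ :=
  GRing.isZmodMorphism.Build V quotmod quotmod_proj
    quotmod_proj_is_zmod_morphism.

Definition quotmod_scale (a : k) (q : quotmod) : quotmod :=
  quotmod_proj (a *: repr q).

Lemma quotmod_scale_proj a v :
  quotmod_scale a (quotmod_proj v) = quotmod_proj (a *: v).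
Proof.
apply/quotmod_projP; rewrite -scalerBr rpredZ //.
by apply/quotmod_projP; rewrite quotmod_projK.
Qed.

Lemma quotmod_scaleA a b q :
  quotmod_scale a (quotmod_scale b q) = quotmod_scale (a * b) q.
Proof. by rewrite -(quotmod_projK q) !quotmod_scale_proj scalerA. Qed.

Lemma quotmod_scale1 : left_id 1 quotmod_scale.
Proof. by move=> q; rewrite -(quotmod_projK q) quotmod_scale_proj scale1r. Qed.

Lemma quotmod_scaleDr : right_distributive quotmod_scale +%R.
Proof.
move=> a p q; rewrite -(quotmod_projK p) -(quotmod_projK q).
by rewrite -raddfD !quotmod_scale_proj scalerDr raddfD.
Qed.

Lemma quotmod_scaleDl q : {morph quotmod_scale^~ q : a b / a + b}.
Proof.
move=> a b; rewrite -(quotmod_projK q) !quotmod_scale_proj.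
by rewrite scalerDl raddfD.
Qed.

HB.instance Definition _ := GRing.Zmodule_isLmodule.Build k quotmod
  quotmod_scaleA quotmod_scale1 quotmod_scaleDr quotmod_scaleDl.

Lemma quotmod_proj_is_scalable : scalable quotmod_proj.
Proof. by move=> a v; rewrite -quotmod_scale_proj. Qed.

HB.instance Definition _ :=
  GRing.isScalable.Build k V quotmod *:%R quotmod_proj
    quotmod_proj_is_scalable.

End QuotientModule.

(* tensor V W is the free vector space on V * W modulo the subspace generated by
   the bilinearity relations. *)

Section Tensor.
Context (k : fieldType).

Section TensorDef.
Context (V W : lmodType k).

Let free := {freeg (V * W)%type / k}.

Definition gen (v : V) (w : W) : free := [freeg [:: (1, (v, w))]].

Variant tensor_relation : free -> Prop :=
| TensorLinearl a v v' w :
    tensor_relation (gen (a *: v + v') w - (a *: gen v w + gen v' w))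
| TensorLinearr a v w w' :
    tensor_relation (gen v (a *: w + w') - (a *: gen v w + gen v w')).

Definition tensor_relations : {pred free} := fun x =>
  `[< forall P : submodClosed free,
        (forall y, tensor_relation y -> y \in P) -> x \in P >].

Lemma tensor_relations_submod : submod_closed tensor_relations.
Proof.
split=> [|a x y /asboolP xP /asboolP yP]; apply/asboolP => P hP.
  exact: rpred0.
by rewrite rpredD ?rpredZ ?xP ?yP.
Qed.

HB.instance Definition _ :=
  GRing.isSubmodClosed.Build k free tensor_relations tensor_relations_submod.

Definition tensor_ker : submodClosed free :=
  GRing.SubmodClosed.clone k free tensor_relations _.

Definition tensor : Type := quotmod tensor_ker.

HB.instance Definition _ := GRing.Lmodule.on tensor.

Definition pure (v : V) (w : W) : tensor :=
  quotmod_proj tensor_ker (gen v w).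

(* The linear map induced by B; only meaningful when B is bilinear. *)
Definition tlift (X : lmodType k) (B : V -> W -> X) (t : tensor) : X :=
  fglift (fun p => B p.1 p.2) (repr (t : quotmod tensor_ker)).

Lemma tensor_relationE y : tensor_relation y ->
  quotmod_proj tensor_ker y = 0.
Proof.
move=> hy; rewrite -[RHS](raddf0 (quotmod_proj tensor_ker)).
by apply/quotmod_projP; rewrite subr0; apply/asboolP => P; apply.
Qed.

Lemma pure_linearl w : linear (pure^~ w).
Proof.
move=> a v v'; have := tensor_relationE (TensorLinearl a v v' w).
by rewrite raddfB /= linearP => /eqP; rewrite subr_eq0 => /eqP.
Qed.

Lemma pure_linearr v : linear (pure v).
Proof.
move=> a w w'; have := tensor_relationE (TensorLinearr a v w w').
by rewrite raddfB /= linearP => /eqP; rewrite subr_eq0 => /eqP.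
Qed.


Lemma fglift_zmod_morphism (X : lmodType k) (f : V * W -> X) :
  zmod_morphism (fglift f : free -> X).
Proof. exact: lift_is_additive. Qed.

Lemma fglift_linear (X : lmodType k) (f : V * W -> X) :
  linear (fglift f : free -> X).
Proof.
pose F : free -> X := fglift f.
have FD : zmod_morphism F := fglift_zmod_morphism f.
pose Fa := GRing.isZmodMorphism.Build _ _ F FD.
pose FA : {additive free -> X} := HB.pack F Fa.
move=> a x y; rewrite -[fglift f]/(FA : _ -> _) raddfD; congr (_ + _).
have FE : FA x = \sum_(p <- dom x) coeff p x *: f p.
  rewrite -{1}[x]freeg_sumE raddf_sum; apply: eq_bigr => p _.
  by rewrite /= /F liftU.
rewrite FE scaler_sumr -[a *: x]/(fgscale a x) /fgscale raddf_sum.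
by apply: eq_bigr => p _; rewrite /= /F liftU scalerA.
Qed.

Lemma fglift_linear_rel (X : lmodType k) (B : V -> W -> X) :
  bilinear_for *:%R *:%R B ->
  forall y, y \in tensor_ker -> fglift (fun p => B p.1 p.2) y = 0.
Proof.
move=> [Bl Br] y /asboolP hy.
pose F : free -> X := fglift (fun p => B p.1 p.2).
have FL : linear F := @fglift_linear X (fun p => B p.1 p.2).
pose Fl := GRing.isLinear.Build _ _ _ _ F FL.
pose G : {linear free -> X} := HB.pack F Fl.
pose P : {pred free} := fun x => G x == 0.
have hP : submod_closed P.
  split=> [|a x z]; rewrite !unfold_in ?raddf0 //.
  by move=> /eqP hx /eqP hz; rewrite linearP hx hz scaler0 addr0.
pose Pm := GRing.isSubmodClosed.Build k free P hP.
pose Q : submodClosed free := HB.pack P Pm.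
have GB x z : G (x - z) = G x - G z by exact: raddfB.
have GP a x z : G (a *: x + z) = a *: G x + G z by exact: linearP.
have FU v w : G (gen v w) = B v w by rewrite /= /F /gen liftU scale1r.
apply/eqP; apply: (hy Q) => _ [a v v' w|a v w w']; rewrite /Q !unfold_in /P.
  by rewrite GB GP !FU /= (Bl w a v v') subrr.
by rewrite GB GP !FU /= (Br v a w w') subrr.
Qed.

Section Lift.
Context (X : lmodType k) (B : V -> W -> X).
Hypothesis B_bilinear : bilinear_for *:%R *:%R B.

Lemma tlift_proj (y : free) :
  tlift B (quotmod_proj tensor_ker y) = fglift (fun p => B p.1 p.2) y.
Proof.
apply/eqP; rewrite -subr_eq0 /tlift.
rewrite -[_ - _](@lift_is_additive _ _ _ (fun p : V * W => B p.1 p.2)).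
apply/eqP/fglift_linear_rel => //.
by apply/quotmod_projP; rewrite quotmod_projK.
Qed.

Lemma tlift_linear : linear (tlift B).
Proof.
move=> a x y; rewrite -(quotmod_projK x) -(quotmod_projK y).
rewrite -(linearP (quotmod_proj tensor_ker)) !tlift_proj.
exact: fglift_linear.
Qed.

Lemma tlift_pure v w : tlift B (pure v w) = B v w.
Proof. by rewrite tlift_proj liftU scale1r. Qed.

End Lift.

Lemma tensor_sum (t : tensor) :
  exists s : seq (V * W), t = \sum_(p <- s) pure p.1 p.2.
Proof.
have pureZ (a : k) v w : quotmod_proj tensor_ker [freeg [:: (a, (v, w))]] =
    pure (a *: v) w.
  have pure0 : pure 0 w = 0.
    by have := pure_linearl w (- 1) 0 0; rewrite scaler0 addr0 scaleN1r addNr.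
  have := pure_linearl w a v 0; rewrite pure0 !addr0 => ->.
  rewrite -[RHS](quotmod_proj_is_scalable tensor_ker); congr (quotmod_proj _ _).
  by apply/eqP/freeg_eqP => z; rewrite coeffZ !coeffU mul1r.
rewrite -(quotmod_projK t); set x := repr _.
exists [seq (coeff p x *: p.1, p.2) | p <- dom x].
rewrite big_map -{1}[x]freeg_sumE raddf_sum /=.
elim: (dom x) => [|[v w] r IHr]; first by rewrite !big_nil.
by rewrite !big_cons IHr /= pureZ.
Qed.

Lemma tensor_ext (X : lmodType k) (f g : tensor -> X) :
  linear f -> linear g -> (forall v w, f (pure v w) = g (pure v w)) ->
  f =1 g.
Proof.
move=> fL gL fg t.
pose Fl := GRing.isLinear.Build _ _ _ _ f fL.
pose F : {linear tensor -> X} := HB.pack f Fl.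
pose Gl := GRing.isLinear.Build _ _ _ _ g gL.
pose G : {linear tensor -> X} := HB.pack g Gl.
have [s ->] := tensor_sum t.
rewrite [LHS](raddf_sum F) [RHS](raddf_sum G).
by apply: eq_bigr => p _; apply: fg.
Qed.

End TensorDef.
Section TensorMaps.
Context (U V W U' V' W' : lmodType k).

Lemma pure_bilinear : bilinear_for *:%R *:%R (@pure U V).
Proof. by split=> [v|u] a x y; [apply: pure_linearl|apply: pure_linearr]. Qed.

(* As for tlift, only meaningful when f and g are linear. *)
Definition tmap (f : U -> U') (g : V -> V') : tensor U V -> tensor U' V' :=
  tlift (fun u v => pure (f u) (g v)).

Definition tassoc : tensor (tensor U V) W -> tensor U (tensor V W) :=
  tlift (fun t w => tlift (fun u v => pure u (pure v w)) t).

Lemma tmap_bilinear (f : U -> U') (g : V -> V') : linear f -> linear g ->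
  bilinear_for *:%R *:%R (fun u v => pure (f u) (g v)).
Proof.
move=> fL gL; split=> [v|u] a x y /=.
  by rewrite fL; apply: pure_linearl.
by rewrite gL; apply: pure_linearr.
Qed.

Lemma tmap_linear (f : U -> U') (g : V -> V') :
  linear f -> linear g -> linear (tmap f g).
Proof. by move=> fL gL; apply/tlift_linear/tmap_bilinear. Qed.

Lemma tmap_pure (f : U -> U') (g : V -> V') u v : linear f -> linear g ->
  tmap f g (pure u v) = pure (f u) (g v).
Proof. by move=> fL gL; apply/tlift_pure/tmap_bilinear. Qed.

Lemma tassoc_inner_bilinear (w : W) :
  bilinear_for *:%R *:%R (fun (u : U) (v : V) => pure u (pure v w)).
Proof.
split=> [v|u] a x y /=; first exact: pure_linearl.
by rewrite (pure_linearl w a x y); apply: pure_linearr.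
Qed.

Lemma tassoc_bilinear : bilinear_for *:%R *:%R
  (fun (t : tensor U V) (w : W) => tlift (fun u v => pure u (pure v w)) t).
Proof.
split=> [w|t] a x y; first exact: (tlift_linear (tassoc_inner_bilinear w)).
pose L (w : W) (t : tensor U V) := tlift (fun (u : U) (v : V) => pure u (pure v w)) t.
rewrite -/(L _ _) -/(L x t) -/(L y t).
have LL w : linear (L w) := tlift_linear (tassoc_inner_bilinear w).
apply: (@tensor_ext _ _ _ (L (a *: x + y)) (fun t => a *: L x t + L y t)).
- exact: LL.
- move=> b t1 t2; rewrite !LL !scalerDr !scalerA (mulrC a b) -!addrA.
  by congr (_ + _); rewrite addrCA.
- move=> u v; rewrite /L !(tlift_pure (tassoc_inner_bilinear _)).
  by rewrite (pure_linearr v a x y) (pure_linearr u).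
Qed.

Lemma tassoc_linear : linear tassoc.
Proof. exact: (tlift_linear tassoc_bilinear). Qed.

Lemma tassoc_pure u v w : tassoc (pure (pure u v) w) = pure u (pure v w).
Proof.
rewrite [LHS](tlift_pure tassoc_bilinear).
exact: (tlift_pure (tassoc_inner_bilinear w)).
Qed.

End TensorMaps.

Section TensorMapsTheory.
Context (U V W U' V' W' U'' V'' : lmodType k).

Lemma comp_linear (X Y Z : lmodType k) (f : X -> Y) (g : Y -> Z) :
  linear f -> linear g -> linear (g \o f).
Proof. by move=> fL gL a x y; rewrite /= fL gL. Qed.

Lemma id_linear (X : lmodType k) : linear (@id X).
Proof. by []. Qed.

Lemma tmap_id : tmap (@id U) (@id V) =1 id.
Proof.
apply: tensor_ext => [||u v]; first exact: tmap_linear.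
  exact: id_linear.
exact: tmap_pure.
Qed.

Lemma tmap_comp (f : U -> U') (f' : U' -> U'') (g : V -> V') (g' : V' -> V'') :
  linear f -> linear f' -> linear g -> linear g' ->
  forall t, tmap f' g' (tmap f g t) = tmap (f' \o f) (g' \o g) t.
Proof.
move=> fL fL' gL gL'; apply: (@tensor_ext _ _ _ (tmap f' g' \o tmap f g)).
- by apply: comp_linear; apply: tmap_linear.
- by apply: tmap_linear; apply: comp_linear.
- by move=> u v /=; rewrite !tmap_pure //; apply: comp_linear.
Qed.

Lemma tmap_addl (a : k) (f f' : U -> U') (g : V -> V') :
  linear f -> linear f' -> linear g ->
  forall t, tmap (a *: f + f') g t = a *: tmap f g t + tmap f' g t.
Proof.
move=> fL fL' gL.
have afL : linear (a *: f + f').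
  move=> b x y; rewrite -![(a *: f + f') _]/(a *: f _ + f' _) fL fL'.
  rewrite !scalerDr !scalerA (mulrC a b) -!addrA.
  by congr (_ + _); rewrite addrCA.
apply: (@tensor_ext _ _ _ (tmap (a *: f + f') g)
          (fun t => a *: tmap f g t + tmap f' g t)).
- exact: tmap_linear.
- move=> b x y; rewrite !tmap_linear // !scalerDr !scalerA (mulrC a b) -!addrA.
  by congr (_ + _); rewrite addrCA.
- by move=> u v; rewrite !tmap_pure //; apply: pure_linearl.
Qed.

Lemma tassoc_tmap (f : U -> U') (g : V -> V') (h : W -> W') :
  linear f -> linear g -> linear h ->
  forall t, tassoc (tmap (tmap f g) h t) = tmap f (tmap g h) (tassoc t).
Proof.
move=> fL gL hL.
have fgL := tmap_linear fL gL; have ghL := tmap_linear gL hL.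
have L1 : linear (@tassoc U' V' W' \o tmap (tmap f g) h).
  by apply: comp_linear; [apply: tmap_linear|apply: tassoc_linear].
have L2 : linear (tmap f (tmap g h) \o @tassoc U V W).
  by apply: comp_linear; [apply: tassoc_linear|apply: tmap_linear].
apply: (tensor_ext L1 L2) => t w.
pose p w : tensor U V -> tensor (tensor U V) W := fun t => pure t w.
have pL : linear (p w) by move=> a x y; apply: pure_linearl.
apply: (tensor_ext (comp_linear pL L1) (comp_linear pL L2)) => u v /=.
by rewrite /p !(tmap_pure, tassoc_pure).
Qed.

End TensorMapsTheory.
End Tensor.

Record coalgebra (k : fieldType) := Coalgebra {
  coalgebra_sort :> lmodType k;
  comul : {linear coalgebra_sort -> tensor coalgebra_sort coalgebra_sort};
  counit : {linear coalgebra_sort -> k^o};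
  comulA : forall c, tassoc (tmap comul id (comul c)) = tmap id comul (comul c);
  counitl : forall c, tlift (fun c1 c2 => counit c1 *: c2) (comul c) = c;
  counitr : forall c, tlift (fun c1 c2 => counit c2 *: c1) (comul c) = c
}.

Section Comodule.
Context (k : fieldType) (C : coalgebra k).

Record comodule := Comodule {
  comodule_sort :> lmodType k;
  coact : {linear comodule_sort -> tensor comodule_sort C};
  coactA : forall m,
    tassoc (tmap coact id (coact m)) = tmap id (comul C) (coact m);
  coact_counit : forall m, tlift (fun m0 c => counit C c *: m0) (coact m) = m
}.

Definition regular_comodule : comodule :=
  Comodule (coact := comul C) (@comulA k C) (@counitr k C).

(* comodule_hom M N is Com_C(M, N), a k-vector space. *)
Section Hom.
Context (M N : comodule).

Definition comodule_morphism : {pred M -> N} := fun f =>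
  `[< linear f /\ forall m, coact N (f m) = tmap f id (coact M m) >].

Lemma comodule_morphism_submod : submod_closed comodule_morphism.
Proof.
have id_L : linear (@id C) by [].
have zL : linear (0 : M -> N) by move=> a x y; rewrite /= scaler0 addr0.
split.
  apply/asboolP; split=> // m; rewrite raddf0.
  have := tmap_addl (- 1) zL zL id_L (coact M m).
  by rewrite scaler0 addr0 scaleN1r addNr.
move=> a f g /asboolP[fL fC] /asboolP[gL gC]; apply/asboolP; split.
  move=> b x y; rewrite -![(a *: f + g) _]/(a *: f _ + g _) fL gL.
  rewrite !scalerDr !scalerA (mulrC a b) -!addrA.
  by congr (_ + _); rewrite addrCA.
move=> m; rewrite tmap_addl // -fC -gC.
exact: linearP.
Qed.

HB.instance Definition _ := GRing.isSubmodClosed.Build k (M -> N)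
  comodule_morphism comodule_morphism_submod.

Record comodule_hom := ComoduleHom {
  comodule_fun :> M -> N;
  _ : comodule_fun \in comodule_morphism
}.

HB.instance Definition _ := [isSub for comodule_fun].
HB.instance Definition _ := [Choice of comodule_hom by <:].
HB.instance Definition _ := [SubChoice_isSubLmodule of comodule_hom by <:].

Lemma comodule_homP (f : comodule_hom) :
  linear f /\ forall m, coact N (f m) = tmap f id (coact M m).
Proof. by case: f => f /= /asboolP. Qed.

Lemma comodule_hom_ext (f g : comodule_hom) : f =1 g -> f = g.
Proof. by move=> fg; apply: val_inj; apply/funext. Qed.

End Hom.

End Comodule.

(* N is a subcomodule when the coaction maps it into the image of N (x) C. *)
Record subcomodule (k : fieldType) (C : coalgebra k) (M : comodule C) :=
  Subcomodule {
    subcomodule_pred :> submodClosed M;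
    coact_sub : forall m, m \in subcomodule_pred ->
      exists2 s : seq (M * C), {in s, forall p, p.1 \in subcomodule_pred} &
        coact M m = \sum_(p <- s) pure p.1 p.2
  }.

Section QuotientComodule.
Context (k : fieldType) (C : coalgebra k) (M : comodule C) (N : subcomodule M).

Let proj : M -> quotmod N := quotmod_proj N.

Let projL : linear proj. Proof. exact: linearP. Qed.
Let coactL : linear (coact M). Proof. exact: linearP. Qed.
Let comulL : linear (comul C). Proof. exact: linearP. Qed.
Let idL : linear (@id C). Proof. by []. Qed.

Definition quot_coact (q : quotmod N) : tensor (quotmod N) C :=
  tmap proj id (coact M (repr q)).

Lemma quot_coact_proj m : quot_coact (proj m) = tmap proj id (coact M m).
Proof.
pose t := tmap proj (@id C); have tL : linear t := tmap_linear projL idL.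
pose F : {linear _ -> _} := HB.pack t (GRing.isLinear.Build _ _ _ _ t tL).
have tB x y : t (x - y) = t x - t y by exact: (raddfB F).
have cB x y : coact M (x - y) = coact M x - coact M y by exact: raddfB.
apply/eqP; rewrite -subr_eq0 /quot_coact -/t -tB -cB.
have /coact_sub[s sN ->] : repr (proj m) - m \in (N : submodClosed M).
  by apply/quotmod_projP; rewrite quotmod_projK.
rewrite [t _](raddf_sum F) big_seq; apply/eqP; apply: big1 => p /sN pN.
rewrite /= /t tmap_pure //.
have -> : proj p.1 = 0.
  rewrite -[RHS](raddf0 (quotmod_proj N)).
  by apply/quotmod_projP; rewrite subr0.
have := pure_linearl (p.2 : C) (- 1) (0 : quotmod N) 0.
by rewrite scaler0 addr0 scaleN1r addNr.
Qed.

Lemma quot_coact_linear : linear quot_coact.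
Proof.
move=> a p q; rewrite -(quotmod_projK p) -(quotmod_projK q).
rewrite -[quotmod_proj _ _]/(proj (repr p)) -[quotmod_proj _ (repr q)]/(proj (repr q)).
by rewrite -projL !quot_coact_proj coactL tmap_linear.
Qed.

HB.instance Definition _ :=
  GRing.isLinear.Build k (quotmod N) (tensor (quotmod N) C) *:%R quot_coact
    quot_coact_linear.

Lemma quot_coactA q :
  tassoc (tmap quot_coact id (quot_coact q)) =
  tmap id (comul C) (quot_coact q).
Proof.
have qL := quot_coact_linear.
have iL : linear (@id (quotmod N)) by [].
rewrite -(quotmod_projK q) -[quotmod_proj _ _]/(proj (repr q)).
rewrite quot_coact_proj !tmap_comp //.
have -> : quot_coact \o proj = tmap proj id \o coact M.
  by apply/funext => m; apply: quot_coact_proj.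
rewrite -[in LHS](@tmap_comp _ _ _ _ _ _ _ (coact M) _ id id) //; last first.
  exact: tmap_linear.
rewrite tassoc_tmap // coactA !tmap_comp //; last exact: tmap_linear.
by congr (tmap _ _ _); apply/funext => c; rewrite /= tmap_id.
Qed.

Lemma quot_coact_counit q :
  tlift (fun p c => counit C c *: p) (quot_coact q) = q.
Proof.
have B (X : lmodType k) :
    bilinear_for *:%R *:%R (fun (x : X) (c : C) => counit C c *: x).
  split=> [c|x] a y z /=; first by rewrite scalerDr !scalerA mulrC.
  by rewrite linearP scalerDl scalerA.
rewrite -(quotmod_projK q) -[quotmod_proj _ _]/(proj (repr q)).
rewrite quot_coact_proj -[in RHS](coact_counit (repr q)).
move: (coact M (repr q)).
pose f : tensor (quotmod N) C -> quotmod N :=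
  tlift (fun x c => counit C c *: x).
pose g : tensor M C -> M := tlift (fun x c => counit C c *: x).
have fL : linear f := tlift_linear (B _).
have gL : linear g := tlift_linear (B _).
have tL : linear (tmap proj (@id C)) := tmap_linear projL idL.
apply: (tensor_ext (comp_linear tL fL) (comp_linear gL projL)) => m c /=.
rewrite tmap_pure // /f /g !(tlift_pure (B _)).
by rewrite [RHS]quotmod_proj_is_scalable.
Qed.

Definition quotient_comodule : comodule C :=
  Comodule quot_coactA quot_coact_counit.

End QuotientComodule.

Section ComoduleNotions.
Context (k : fieldType) (C : coalgebra k).

Definition simple (S : comodule C) : Prop :=
  (exists x : S, x != 0) /\
  forall N : subcomodule S,
    (forall x, x \in (N : submodClosed S) -> x = 0) \/
    (forall x, x \in (N : submodClosed S)).

Definition isomorphic (M N : comodule C) : Prop :=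
  exists f : comodule_hom M N, bijective f.

Definition injective_comodule (E : comodule C) : Prop :=
  forall (X Y : comodule C) (i : comodule_hom X Y), injective i ->
  forall f : comodule_hom X E, exists g : comodule_hom Y E,
    forall x, g (i x) = f x.

Definition essential (M N : comodule C) (i : comodule_hom M N) : Prop :=
  injective i /\
  forall P : subcomodule N,
    (exists2 y, y \in (P : submodClosed N) & y != 0) ->
    exists2 x : M, i x \in (P : submodClosed N) & x != 0.

Definition injective_hull (M E : comodule C) (i : comodule_hom M E) : Prop :=
  injective_comodule E /\ essential i.

Definition finite_dimensional (V : lmodType k) : Prop :=
  exists n : nat, inhabited (Vector.axiom n V).

Definition quasi_finite (M : comodule C) : Prop :=
  forall S : comodule C, simple S -> finite_dimensional (comodule_hom S M).

Definition strictly_quasi_finite (M : comodule C) : Prop :=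
  forall N : subcomodule M, quasi_finite (quotient_comodule N).

Definition simple_representatives (I : Type) (S : I -> comodule C) : Prop :=
  [/\ forall i, simple (S i),
      forall i j, isomorphic (S i) (S j) -> i = j &
      forall M : comodule C, simple M -> exists i, isomorphic M (S i)].

(* The objects of the localizing subcategory T_E. *)
Definition torsion (E M : comodule C) : Prop :=
  forall f : comodule_hom M E, f = 0.

End ComoduleNotions.

Record preadditive := Preadditive {
  object :> Type;
  hom : object -> object -> zmodType;
  idm : forall A, hom A A;
  comp : forall A B D, hom B D -> hom A B -> hom A D;
  comp1m : forall A B (f : hom A B), comp (idm B) f = f;
  compm1 : forall A B (f : hom A B), comp f (idm A) = f;
  compmA : forall A B D E (h : hom D E) (g : hom B D) (f : hom A B),
    comp h (comp g f) = comp (comp h g) f;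
  compDl : forall A B D (g g' : hom B D) (f : hom A B),
    comp (g + g') f = comp g f + comp g' f;
  compDr : forall A B D (g : hom B D) (f f' : hom A B),
    comp g (f + f') = comp g f + comp g f'
}.

Arguments idm {p} A.
Arguments comp {p A B D} g f.

Notation "g ∘m f" := (comp g f) (at level 40, left associativity).

Section Preadditive.
Context (D : preadditive).
Implicit Types A B X Y : D.

Definition zero_object X : Prop :=
  forall Y, (forall f : hom X Y, f = 0) /\ (forall f : hom Y X, f = 0).

Definition isomorphism A B (f : hom A B) : Prop :=
  exists2 g : hom B A, g ∘m f = idm A & f ∘m g = idm B.

Definition monic A B (f : hom A B) : Prop :=
  forall X (g h : hom X A), f ∘m g = f ∘m h -> g = h.

Definition epic A B (f : hom A B) : Prop :=
  forall X (g h : hom B X), g ∘m f = h ∘m f -> g = h.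

Definition is_kernel X A B (i : hom X A) (f : hom A B) : Prop :=
  f ∘m i = 0 /\
  forall Y (g : hom Y A), f ∘m g = 0 -> exists! h : hom Y X, i ∘m h = g.

Definition is_cokernel A B X (p : hom B X) (f : hom A B) : Prop :=
  p ∘m f = 0 /\
  forall Y (g : hom B Y), g ∘m f = 0 -> exists! h : hom X Y, h ∘m p = g.

Definition is_product A B X (p : hom X A) (q : hom X B) : Prop :=
  forall Y (f : hom Y A) (g : hom Y B),
    exists! h : hom Y X, p ∘m h = f /\ q ∘m h = g.

Definition abelian : Prop :=
  [/\ exists X, zero_object X,
      forall A B, exists X (p : hom X A) (q : hom X B), is_product p q,
      forall A B (f : hom A B),
        (exists X (i : hom X A), is_kernel i f) /\
        (exists X (p : hom B X), is_cokernel p f),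
      forall A B (f : hom A B), monic f ->
        exists X (p : hom B X), is_kernel f p &
      forall A B (f : hom A B), epic f ->
        exists X (i : hom X A), is_cokernel f i].

(* 0 -> A -> B -> X -> 0 *)
Definition short_exact A B X (i : hom A B) (p : hom B X) : Prop :=
  is_kernel i p /\ is_cokernel p i.

(* Descending chain condition on subobjects: U n.+1 is contained in U n, and
   from some index on U n is contained in U n.+1. *)
Definition artinian X : Prop :=
  forall (U : nat -> D) (u : forall n, hom (U n) X),
    (forall n, monic (u n)) ->
    (forall n, exists t : hom (U n.+1) (U n), u n ∘m t = u n.+1) ->
    exists n0, forall n, (n0 <= n)%N ->
      exists t : hom (U n) (U n.+1), u n.+1 ∘m t = u n.

End Preadditive.

Record functor (A B : preadditive) := Functor {
  fobj :> A -> B;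
  fmap : forall X Y, hom X Y -> hom (fobj X) (fobj Y);
  fmap_id : forall X, fmap (idm X) = idm (fobj X);
  fmap_comp : forall X Y Z (g : hom Y Z) (f : hom X Y),
    fmap (g ∘m f) = fmap g ∘m fmap f
}.

Arguments fmap {A B} _ {X Y} _.

Definition exact_functor (A B : preadditive) (F : functor A B) : Prop :=
  (forall X Y (f g : hom X Y), fmap F (f + g) = fmap F f + fmap F g) /\
  (forall X Y Z (i : hom X Y) (p : hom Y Z),
     short_exact i p -> short_exact (fmap F i) (fmap F p)).

Record adjunction (A B : preadditive) (F : functor A B) (G : functor B A) :=
  Adjunction {
    adj_unit : forall X, hom X (G (F X));
    adj_counit : forall Y, hom (F (G Y)) Y;
    adj_unit_natural : forall X X' (f : hom X X'),
      adj_unit X' ∘m f = fmap G (fmap F f) ∘m adj_unit X;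
    adj_counit_natural : forall Y Y' (g : hom Y Y'),
      adj_counit Y' ∘m fmap F (fmap G g) = g ∘m adj_counit Y;
    adj_triangleF : forall X,
      adj_counit (F X) ∘m fmap F (adj_unit X) = idm (F X);
    adj_triangleG : forall Y,
      fmap G (adj_counit Y) ∘m adj_unit (G Y) = idm (G Y)
  }.

(* A/T is only determined up to equivalence: any such data is a localization
   functor A -> A/T. *)
Record localization (A : preadditive) (T : A -> Prop) := Localization {
  loc_category : preadditive;
  loc_abelian : abelian loc_category;
  loc_functor :> functor A loc_category;
  loc_exact : exact_functor loc_functor;
  loc_kernel : forall X, zero_object (loc_functor X) <-> T X;
  loc_section : functor loc_category A;
  loc_adjunction : adjunction loc_functor loc_section;
  loc_counit_iso : forall Y, isomorphism (adj_counit loc_adjunction Y)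
}.

Section ComoduleCategory.
Context (k : fieldType) (C : coalgebra k).
Implicit Types M N P Q : comodule C.

Lemma comodule_idm_subproof M : id \in @comodule_morphism k C M M.
Proof. by apply/asboolP; split=> // m; rewrite tmap_id. Qed.

Definition comodule_idm M : comodule_hom M M :=
  ComoduleHom (comodule_idm_subproof M).

Lemma comodule_comp_subproof M N P (g : comodule_hom N P)
  (f : comodule_hom M N) : g \o f \in @comodule_morphism k C M P.
Proof.
have [fL fC] := comodule_homP f; have [gL gC] := comodule_homP g.
apply/asboolP; split; first exact: comp_linear.
by move=> m; rewrite /= gC fC tmap_comp.
Qed.

Definition comodule_comp M N P (g : comodule_hom N P) (f : comodule_hom M N) :
  comodule_hom M P := ComoduleHom (comodule_comp_subproof g f).

Lemma comodule_comp1m M N (f : comodule_hom M N) :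
  comodule_comp (comodule_idm N) f = f.
Proof. exact: comodule_hom_ext. Qed.

Lemma comodule_compm1 M N (f : comodule_hom M N) :
  comodule_comp f (comodule_idm M) = f.
Proof. exact: comodule_hom_ext. Qed.

Lemma comodule_compA M N P Q (h : comodule_hom P Q) (g : comodule_hom N P)
  (f : comodule_hom M N) :
  comodule_comp h (comodule_comp g f) = comodule_comp (comodule_comp h g) f.
Proof. exact: comodule_hom_ext. Qed.

Lemma comodule_compDl M N P (g g' : comodule_hom N P) (f : comodule_hom M N) :
  comodule_comp (g + g') f = comodule_comp g f + comodule_comp g' f.
Proof. exact: comodule_hom_ext. Qed.

Lemma comodule_compDr M N P (g : comodule_hom N P) (f f' : comodule_hom M N) :
  comodule_comp g (f + f') = comodule_comp g f + comodule_comp g f'.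
Proof.
apply: comodule_hom_ext => m; have [gL _] := comodule_homP g.
rewrite -[LHS]/(g (f m + f' m)) -[RHS]/(g (f m) + g (f' m)).
by rewrite -[f m in LHS]scale1r gL scale1r.
Qed.

Definition comodule_category : preadditive :=
  Preadditive comodule_comp1m comodule_compm1 comodule_compA
    comodule_compDl comodule_compDr.

End ComoduleCategory.

(* Main.v *)
(* Fix i, with simple comodule S = S_i and hull E = E_i, and let Q be the class
   of comodules M such that Com(S, M/N) is finite-dimensional for all N <= M.
   Q and the torsion class of E are closed under subobjects, quotients and
   extensions, and torsion comodules lie in Q; moreover M is strictly
   quasi-finite iff it lies in Q for every i.
   The heart of the proof is that for X in Q any family of maps X -> E has a
   finite subfamily with the same common kernel, whereas if Com(S, X/N) is
   infinite-dimensional there are sequences of maps X/N -> E with strictly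
   decreasing partial common kernels. Hence X lies in Q iff it satisfies a
   descending chain condition modulo torsion, and exactness and the section
   functor identify this with T_i(X) being artinian. For X = C it also excludes
   infinitely many non-torsion E_j, as these would be independent summands of C.
   If only finitely many E_j are non-torsion, a quasi-finite M admits finitely
   many maps to these E_j whose common kernel K contains no S_j with E_j
   non-torsion; then K is torsion, so M is in Q as soon as all the E_j are. *)

Require Import Defs.
From HB Require Import structures.
From mathcomp Require Import all_boot all_algebra.
From mathcomp Require Import all_classical.
(* mathcomp redefines hom and monic. *)
Import Defs.

Set Implicit Arguments.
Unset Strict Implicit.
Unset Printing Implicit Defensive.

Import GRing.Theory.
Local Open Scope ring_scope.

(** * Vector spaces *)

Section LinearAlgebra.
Context (k : fieldType).
Implicit Types V W X Y : lmodType k.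

Definition mklinear V W (f : V -> W) (fL : linear f) : {linear V -> W} :=
  HB.pack f (GRing.isLinear.Build k V W *:%R f fL).

Definition is_submod V (P : V -> Prop) : Prop :=
  P 0 /\ forall a x y, P x -> P y -> P (a *: x + y).

Lemma is_submod_closed V (P : V -> Prop) : is_submod P ->
  submod_closed (fun x => `[< P x >]).
Proof.
move=> [P0 PL]; split=> [|a x y /asboolP Px /asboolP Py]; apply/asboolP => //.
exact: PL.
Qed.

Definition submod_of V (P : V -> Prop) (PS : is_submod P) : submodClosed V :=
  HB.pack (fun x => `[< P x >])
    (GRing.isSubmodClosed.Build k V _ (is_submod_closed PS)).

#[global] Arguments submod_of : simpl never.

Lemma submod_ofP V (P : V -> Prop) (PS : is_submod P) x :
  x \in submod_of PS <-> P x.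
Proof. by split=> /asboolP. Qed.

Lemma submodN V (U : submodClosed V) x : x \in U -> - x \in U.
Proof. by move=> xU; rewrite -scaleN1r rpredZ. Qed.

Lemma submodB V (U : submodClosed V) x y : x \in U -> y \in U -> x - y \in U.
Proof. by move=> xU yU; rewrite rpredD ?submodN. Qed.

(** Zorn's lemma gives a subspace [H] containing [U] and maximal among those avoiding [v].
    Maximality makes [H] a complement of the line through [v], and the functional reads off the
    coordinate along [v]. *)
Lemma exists_functional V (U : submodClosed V) v : v \notin U ->
  exists2 f : {linear V -> k^o}, f v = 1 & forall u, u \in U -> f u = 0.
Proof.
move=> vU.
(* [A] is only required to form a subspace together with [U], so that the empty union, for the empty
   chain, is admissible. *)
pose UA (A : set V) x := x \in U \/ A x.
pose P (A : set V) :=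
  (forall a x y, UA A x -> UA A y -> UA A (a *: x + y)) /\ ~ A v.
have [A [[AL Av] Amax]] : exists A, P A /\ forall B, (A `<` B)%classic -> ~ P B.
  apply: Zorn_bigcup => F FP Ftot; split=> [a x y xF yF|[A FA Av]]; last first.
    exact: (FP _ FA).2.
  have common A x' : F A -> UA A x' -> UA (\bigcup_(X in F) X)%classic x'.
    by move=> FA [|Ax]; [left|right; exists A].
  have [xU|xU] := boolP (x \in U); have [yU|yU] := boolP (y \in U).
  - by left; rewrite rpredD ?rpredZ.
  - case: yF => [yU'|[A FA Ay]]; first by rewrite yU' in yU.
    by apply: (common A) => //; apply: (FP _ FA).1; [left|right].
  - case: xF => [xU'|[A FA Ax]]; first by rewrite xU' in xU.
    by apply: (common A) => //; apply: (FP _ FA).1; [right|left].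
  case: xF => [xU'|[A FA Ax]]; first by rewrite xU' in xU.
  case: yF => [yU'|[B FB By]]; first by rewrite yU' in yU.
  have [AB|BA] := Ftot _ _ FA FB.
    by apply: (common B) => //; apply: (FP _ FB).1; right => //; apply: AB.
  by apply: (common A) => //; apply: (FP _ FA).1; right => //; apply: BA.
have AS : is_submod (UA A) by split=> //; left; apply: rpred0.
pose H := submod_of AS; have HP x : x \in H <-> UA A x := submod_ofP AS x.
have vH : v \notin H.
  by apply/negP => /HP[] //; rewrite (negbTE vU).
have decomp x : exists a, x - a *: v \in H.
  have [xH|xH] := boolP (x \in H); first by exists 0; rewrite scale0r subr0.
  (* The sum of [H] and the line through [x]; being strictly larger than [A], it must contain
     [v]. *)
  pose B y := exists2 a, y - a *: x \in H & True.
  have BL a y z : B y -> B z -> B (a *: y + z).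
    move=> [b yb _] [c zc _]; exists (a * b + c) => //.
    rewrite scalerDl -scalerA opprD addrACA -scalerBr.
    by rewrite rpredD ?rpredZ.
  have HB y : y \in H -> B y by move=> yH; exists 0; rewrite ?scale0r ?subr0.
  have Bx : B x by exists 1; rewrite // scale1r subrr rpred0.
  have [[a va _]|Bv] := pselect (B v).
    have a0 : a != 0.
      by apply: contraNneq vH => a0; move: va; rewrite a0 scale0r subr0.
    exists a^-1; rewrite -[x in x - _]scale1r -(mulVf a0) -scalerA -scalerBr.
    by rewrite rpredZ // -opprB submodN.
  exfalso; apply: (Amax B).
    split=> [y Ay|BA]; first by apply/HB/HP; right.
    by move/negP: xH; apply; apply/HP; right; apply: BA.
  split=> // a y z By Bz; right; apply: BL.
    by case: By => // yU; apply/HB/HP; left.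
  by case: Bz => // zU; apply/HB/HP; left.
(* By [decomp] the set is inhabited, so the default 0 is never taken. *)
pose f x : k^o := xget 0 [set a | x - a *: v \in H]%classic.
have fP x : x - f x *: v \in H.
  by have [a xa] := decomp x;
    apply: (@xgetPex _ (0 : k) [set a | x - a *: v \in H]%classic); exists a.
have f_uniq x a : x - a *: v \in H -> f x = a.
  move=> xa; apply/eqP; rewrite -subr_eq0; apply: contraNT vH => fa.
  rewrite -[v]scale1r -(mulVf fa) -scalerA rpredZ // scalerBl.
  by rewrite -(subrKA x) rpredD // -opprB submodN.
have fL : linear f.
  move=> a x y; apply: f_uniq;
    rewrite scalerDl -scalerA opprD addrACA -scalerBr.
  by rewrite rpredD ?rpredZ.
exists (mklinear fL) => [|u uU] /=; apply: f_uniq.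
  by rewrite scale1r subrr rpred0.
by rewrite scale0r subr0; apply/HP; left.
Qed.

(** If [f x0] is nonzero, take a functional that is 1 at [i x0] and kills the image of the kernel of
    [f]. Scaled by [f x0] it extends [f], since [f x0 *: x - f x *: x0] lies in that kernel. *)
Lemma extend_functional X Y (i : {linear X -> Y}) (f : {linear X -> k^o}) :
  injective i -> exists g : {linear Y -> k^o}, forall x, g (i x) = f x.
Proof.
move=> i_inj.
have [[x0 fx0]|f0] := pselect (exists x, f x != 0); last first.
  exists (\0 : {linear Y -> k^o}) => x /=; apply/eqP/negPn/negP => fx.
  by apply: f0; exists x; rewrite eq_sym.
have KS : is_submod (fun y => exists2 x, y = i x & f x = 0).
  split=> [|a _ _ [x -> fx] [y -> fy]]; first by exists 0; rewrite raddf0.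
  by exists (a *: x + y); rewrite linearP // fx fy /= scaler0 addr0.
have [|g g1 g0] := @exists_functional _ (submod_of KS) (i x0).
  by apply/negP => /submod_ofP[x /i_inj <- fx]; rewrite fx eqxx in fx0.
have scaleE (a b : k) : a *: (b : k^o) = a * b by [].
have hL : linear (fun y => f x0 * g y : k^o).
  by move=> a x y; rewrite linearP /= mulrDr mulrCA.
exists (mklinear hL) => x /=.
have fx : f (f x0 *: x - f x *: x0) = 0.
  by apply/eqP; rewrite linearB subr_eq0 !linearZ_LR !scaleE mulrC.
have : g (i (f x0 *: x - f x *: x0)) = 0.
  by apply/g0/submod_ofP; eexists.
rewrite !linearB => /eqP.
by rewrite subr_eq0 !linearZ_LR g1 !scaleE mulr1 => /eqP.
Qed.

(** A [{vspace vT}] of maximal dimension inside [D] is all of [D]: adjoining a vector of [D] cannot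
    enlarge it. *)
Lemma submod_vspace (vT : vectType k) (D : submodClosed vT) :
  exists U : {vspace vT}, forall v, (v \in U) = (v \in D).
Proof.
pose P n := `[< exists U :
  {vspace vT}, \dim U = n /\ forall v, v \in U -> v \in D >].
have exP : exists n, P n.
  exists 0%N; apply/asboolP; exists 0%VS; split=> [|v]; first exact: dimv0.
  by rewrite memv0 => /eqP ->; apply: rpred0.
have bP n : P n -> (n <= \dim (@fullv k vT))%N.
  by move=> /asboolP[U [<- _]]; apply/dimvS/subvf.
case: (ex_maxnP exP bP) => n /asboolP[U [dU UD]] nmax.
exists U => v; apply/idP/idP => [/UD //|vD].
have /nmax : P (\dim (U + <[v]>)%VS).
  apply/asboolP; exists (U + <[v]>)%VS; split=> // w.
  move=> /memv_addP[u uU [_ /vlineP[a ->] ->]].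
  by rewrite rpredD ?rpredZ // UD.
rewrite -dU => dle; have /eqP -> : U == (U + <[v]>)%VS.
  by rewrite eqEdim addvSl.
by rewrite (subvP (addvSr _ _)) // memv_line.
Qed.

Lemma finite_dimensional_inj V n (f : {linear V -> 'rV[k]_n}) :
  injective f -> finite_dimensional V.
Proof.
move=> f_inj.
have DS : is_submod (fun v => exists x, v = f x).
  split=> [|a _ _ [x ->] [y ->]]; first by exists 0; rewrite raddf0.
  by exists (a *: x + y); rewrite linearP.
have [U UE] := submod_vspace (submod_of DS).
have fU x : f x \in U by rewrite UE; apply/submod_ofP; exists x.
pose g x : subvs_of U := Subvs (fU x).
have gL : linear g by move=> a x y; apply: val_inj; rewrite /= linearP.
have g_bij : bijective g.
  have gE (u : subvs_of U) : exists x, val u = f x.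
    by have := subvsP u; rewrite UE => /submod_ofP.
  exists (fun u => sval (cid (gE u))) => [x|u].
    by case: cid => y /= /f_inj.
  by case: cid => y /= uE; apply: val_inj.
have [v2r vL v_bij] := subvs_vect_iso U.
exists (\dim U); constructor; exists (v2r \o g); last exact: bij_comp.
by move=> a x y; rewrite /= gL vL.
Qed.

Lemma finite_dimensionalP V :
  finite_dimensional V <->
  exists n (f : {linear V -> 'rV[k]_n}), injective f.
Proof.
split=> [[n [[f fL /bij_inj f_inj]]]|[n [f]]];
  last exact: finite_dimensional_inj.
by exists n, (mklinear fL).
Qed.

Lemma finite_dimensional_sub V W (f : {linear V -> W}) :
  injective f -> finite_dimensional W -> finite_dimensional V.
Proof.
move=> f_inj /finite_dimensionalP[n [g g_inj]].
by apply: (@finite_dimensional_inj _ n (g \o f)); apply: inj_comp.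
Qed.

Lemma finite_dimensional0 V : (forall x : V, x = 0) -> finite_dimensional V.
Proof.
move=> V0; apply: (@finite_dimensional_inj _ 0 \0) => x y _.
by rewrite (V0 x) (V0 y).
Qed.

Lemma extend_rV X Y n (i : {linear X -> Y}) (f : {linear X -> 'rV[k]_n}) :
  injective i -> exists g : {linear Y -> 'rV[k]_n}, forall x, g (i x) = f x.
Proof.
move=> i_inj.
have coordL j : linear (fun x => f x 0 j : k^o).
  by move=> a x y; rewrite linearP !mxE.
have /choice[g gE] j : exists g :
  {linear Y -> k^o}, forall x, g (i x) = f x 0 j.
  exact: (extend_functional (mklinear (coordL j)) i_inj).
have gL : linear (fun y => \row_j g j y).
  by move=> a x y; apply/rowP => j; rewrite !mxE linearP.
by exists (mklinear gL) => x; apply/rowP => j; rewrite mxE gE.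
Qed.

(** An embedding of [V] into row vectors extends along [f] to [W]; paired with an embedding of [X]
    pulled back along [g], it has trivial kernel. *)
Lemma finite_dimensional_ext V W X (f : {linear V -> W}) (g : {linear W -> X}) :
  injective f -> (forall w, g w = 0 -> exists v, w = f v) ->
  finite_dimensional V -> finite_dimensional X -> finite_dimensional W.
Proof.
move=> f_inj fg /finite_dimensionalP[n [h h_inj]]
  /finite_dimensionalP[m [l l_inj]].
have [h' h'E] := extend_rV h f_inj.
have rL : linear (fun w => row_mx (h' w) (l (g w))).
  by move=> a x y; rewrite !linearP scale_row_mx add_row_mx.
apply: (@finite_dimensional_inj _ _ (mklinear rL)); apply: raddf_inj => w /=.
rewrite -[0]row_mx0 => /eq_row_mx[h0 /eqP].
rewrite -[X in _ == X](raddf0 l) => /eqP/l_inj/fg[v wE].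
by move: h0; rewrite wE h'E -[RHS](raddf0 h) => /h_inj ->; rewrite raddf0.
Qed.

(** [f] is injective on a complement of its kernel, so sending [x] to the preimage of [g x] in that
    complement is a linear embedding. *)
Lemma finite_dimensional_cover V (vT : vectType k) W (f : {linear vT -> W})
    (g : {linear V -> W}) :
  injective g -> (forall x, exists a, g x = f a) -> finite_dimensional V.
Proof.
move=> g_inj fg.
have KS : is_submod (fun a => f a = 0).
  by split=> [|c a b fa fb]; rewrite ?raddf0 // linearP fa fb scaler0 addr0.
have [K KE] := submod_vspace (submod_of KS).
have f0 a : a \in K -> f a = 0 by rewrite KE => /submod_ofP.
have fC a : f a = 0 -> a \in (K^C)%VS -> a = 0.
  move=> fa aC; apply/eqP; rewrite -memv0 -(capv_compl K) memv_cap aC andbT KE.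
  exact/submod_ofP.
have fg' x : exists2 a, g x = f a & a \in (K^C)%VS.
  have [a ->] := fg x; have : a \in (K + K^C)%VS by rewrite addv_complf memvf.
  by move=> /memv_addP[b bK [c cC ->]]; exists c => //;
    rewrite linearD (f0 b) // add0r.
have h_ex x := cid2 (fg' x).
pose h x := s2val (h_ex x).
have hE x : g x = f (h x) := s2valP (h_ex x).
have hC x : h x \in (K^C)%VS := s2valP' (h_ex x).
have hL : linear h.
  move=> a x y; apply/eqP; rewrite -subr_eq0; apply/eqP/fC.
    by rewrite linearB linearP -!hE linearP subrr.
  by rewrite submodB ?hC // rpredD ?rpredZ ?hC.
have hCL : linear (fun x => Subvs (hC x)).
  by move=> a x y; apply: val_inj; rewrite /= hL.
have [v2r vL v_bij] := subvs_vect_iso (K^C)%VS.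
have vhL : linear (fun x => v2r (Subvs (hC x))).
  by move=> a x y; rewrite hCL vL.
apply: (@finite_dimensional_inj _ _ (mklinear vhL)) =>
  x y /(bij_inj v_bij)[hxy].
by apply: g_inj; rewrite !hE hxy.
Qed.

Lemma finite_dimensional_minimal V (P : submodClosed V -> Prop) :
  finite_dimensional V -> (exists U, P U) ->
  exists2 U, P U &
    forall W : submodClosed V, P W -> {subset W <= U} -> {subset U <= W}.
Proof.
move=> /finite_dimensionalP[n [f f_inj]].
have imS (U : submodClosed V) : is_submod (fun a =>
  exists2 x, x \in U & a = f x).
  split=> [|c _ _ [x xU ->] [y yU ->]]; first by exists 0;
    rewrite ?rpred0 ?raddf0.
  by exists (c *: x + y); rewrite ?rpredD ?rpredZ ?linearP.
pose im U := sval (cid (submod_vspace (submod_of (imS U)))).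
have imE U a : (a \in im U) = (a \in submod_of (imS U)).
  by rewrite (svalP (cid (submod_vspace (submod_of (imS U))))).
have imP (U : submodClosed V) x : (f x \in im U) = (x \in U).
  rewrite imE; apply/idP/idP => [/submod_ofP[y yU /f_inj ->] //|xU].
  by apply/submod_ofP; exists x.
have im_sub (U W : submodClosed V) : {subset W <= U} -> (im W <= im U)%VS.
  by move=> WU; apply/subvP => a; rewrite imE => /submod_ofP[x /WU xU ->];
    rewrite imP.
move=> exP; pose Q d := `[< exists2 U, P U & \dim (im U) = d >].
have exQ : exists d, Q d.
  by have [U PU] := exP; exists (\dim (im U)); apply/asboolP; exists U.
case: (ex_minnP exQ) => d /asboolP[U PU <-] dmin; exists U => // W PW WU.
have /eqP UW : im W == im U.
  by rewrite eqEdim im_sub // dmin //; apply/asboolP; exists W.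
by move=> x; rewrite -!imP UW.
Qed.

Lemma all_submod V (A : Type) (D : A -> submodClosed V) (s : seq A) :
  is_submod (fun v => all (fun a => v \in D a) s).
Proof.
split=> [|c x y xD yD]; first by elim: s => //= a s ->; rewrite rpred0.
elim: s xD yD => //= a s IHs /andP[xa /IHs xs] /andP[ya /xs ->].
by rewrite rpredD ?rpredZ.
Qed.

(** A minimal finite intersection of the [D a] cannot shrink further, so it lies in every [D a]. *)
Lemma finite_subfamily V (A : Type) (D : A -> submodClosed V) :
  finite_dimensional V ->
  exists s : seq A, forall v, all (fun a => v \in D a) s -> forall a, v \in D a.
Proof.
move=> Vfd; pose P U := exists s : seq A, U = submod_of (all_submod D s).
have [|_ [s ->] smin] := finite_dimensional_minimal (P := P) Vfd.
  by eexists; exists [::].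
exists s => v vs a.
have /(_ v) :
    {subset submod_of (all_submod D s) <= submod_of (all_submod D (a :: s))}.
  apply: smin; first by exists (a :: s).
  by move=> x /submod_ofP/andP[_ xs]; apply: (submod_ofP _ _).2 xs.
by move=> /(_ ((submod_ofP _ _).2 vs))/submod_ofP /= /andP[].
Qed.

Lemma finite_dimensional_family V W (A : Type) (f : A -> {linear V -> W})
    (s : seq A) :
  finite_dimensional W -> (forall v, all (fun a => f a v == 0) s -> v = 0) ->
  finite_dimensional V.
Proof.
move=> /finite_dimensionalP[n [h h_inj]].
suff [m [g gP]] : exists m (g : {linear V -> 'rV[k]_m}),
    forall v, g v = 0 -> all (fun a => f a v == 0) s.
  move=> s0; apply: (@finite_dimensional_inj _ m g).
  by apply: raddf_inj => v /gP/s0.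
elim: s => [|a s [m [g gP]]]; first by exists 0, \0.
have rL : linear (fun v => row_mx (h (f a v)) (g v)).
  by move=> c x y; rewrite !linearP scale_row_mx add_row_mx.
exists (n + m), (mklinear rL) => v /=;
  rewrite -[0]row_mx0 => /eq_row_mx[h0 /gP ->].
by rewrite andbT; apply/eqP/h_inj; rewrite h0 raddf0.
Qed.

End LinearAlgebra.

(** * Contracting tensors against functionals *)

Section Slices.
Context (k : fieldType).
Implicit Types V W X : lmodType k.

Lemma slice_bilinear V W (phi : {linear W -> k^o}) :
  bilinear_for *:%R *:%R (fun (v : V) (w : W) => phi w *: v).
Proof.
split=> [w|v] a x y /=; first by rewrite scalerDr !scalerA mulrC.
by rewrite linearP scalerDl scalerA.
Qed.

(* id (x) phi *)
Definition slice V W (phi : {linear W -> k^o}) (t : tensor V W) : V :=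
  tlift (fun v w => phi w *: v) t.

Arguments slice {V W} phi t.

HB.instance Definition _ V W (phi : {linear W -> k^o}) :=
  GRing.isLinear.Build k (tensor V W) V *:%R (slice phi)
    (tlift_linear (@slice_bilinear V W phi)).

Lemma slice_pure V W (phi : {linear W -> k^o}) (v : V) (w : W) :
  slice phi (pure v w) = phi w *: v.
Proof. exact: (tlift_pure (@slice_bilinear V W phi)). Qed.

Lemma slice_tmapl V V' W (f : {linear V -> V'}) (phi : {linear W -> k^o})
    (t : tensor V W) :
  slice phi (tmap f id t) = f (slice phi t).
Proof.
have fL : linear f by exact: linearP.
have idL : linear (@id W) by [].
have tL : linear (slice phi \o tmap f (@id W)).
  by apply: comp_linear; [apply: tmap_linear|apply: linearP].
have sL : linear (f \o @slice V W phi) by exact: linearP.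
by apply: (tensor_ext tL sL) => v w;
  rewrite /= tmap_pure // !slice_pure linearZ_LR.
Qed.

Lemma slice_tmapr V W W' (g : {linear W -> W'}) (phi : {linear W' -> k^o})
    (t : tensor V W) :
  slice phi (tmap id g t) = slice (phi \o g) t.
Proof.
have gL : linear g by exact: linearP.
have idL : linear (@id V) by [].
have tL : linear (slice phi \o tmap (@id V) g).
  by apply: comp_linear; [apply: tmap_linear|apply: linearP].
have sL : linear (@slice V W (phi \o g)) by exact: linearP.
by apply: (tensor_ext tL sL) => v w; rewrite /= tmap_pure // !slice_pure.
Qed.

Lemma pure0l V W (w : W) : pure (0 : V) w = 0.
Proof.
by have := pure_linearl w (- 1) (0 : V) 0; rewrite scaler0 addr0 scaleN1r addNr.
Qed.

(** Tensors with right-hand factors taken from the list [ws]; induction on this list replaces the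
    choice of a basis of [W]. *)
Fixpoint tensors_over V W (ws : seq W) (t : tensor V W) : Prop :=
  if ws is w :: ws' then exists v t', t = pure v w + t' /\ tensors_over ws' t'
  else t = 0.

Lemma tensors_over0 V W (ws : seq W) : tensors_over ws (0 : tensor V W).
Proof. by elim: ws => //= w ws IHws; exists 0, 0; rewrite pure0l addr0. Qed.

Lemma tensors_over_linear V W (ws : seq W) a (t u : tensor V W) :
  tensors_over ws t -> tensors_over ws u -> tensors_over ws (a *: t + u).
Proof.
elim: ws t u => [|w ws IHws] t u /=; first by move=> -> ->;
  rewrite scaler0 addr0.
move=> [v [t' [-> t'P]]] [v' [u' [-> u'P]]].
exists (a *: v + v'), (a *: t' + u'); split; last exact: IHws.
by rewrite pure_linearl scalerDr addrACA.
Qed.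

Lemma tensors_over_pure V W (ws : seq W) (v : V) w :
  w \in ws -> tensors_over ws (pure v w).
Proof.
elim: ws => //= w' ws IHws; rewrite inE => /orP[/eqP <-|/IHws wP].
  by exists v, 0; rewrite addr0; split=> //; apply: tensors_over0.
by exists 0, (pure v w); rewrite pure0l add0r.
Qed.

Lemma tensors_overP V W (t : tensor V W) : exists ws, tensors_over ws t.
Proof.
have [s ->] := tensor_sum t; exists [seq p.2 | p <- s].
elim: s => [|[v w] s IHs]; rewrite ?big_nil ?big_cons //=.
by exists v; eexists.
Qed.

(** Induction on the right-hand factors. If [w] can be absorbed by the others it is dropped.
    Otherwise a functional that is 1 at [w] and kills the others has slice [v], so [v] lies in [U]
    and [pure v w] splits off. *)
Lemma tensor_slices V W (U : submodClosed V) (t : tensor V W) :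
  (forall phi : {linear W -> k^o}, slice phi t \in U) ->
  exists2 s : seq (V * W), {in s, forall p, p.1 \in U} &
    t = \sum_(p <- s) pure p.1 p.2.
Proof.
have [ws] := tensors_overP t; elim: ws t => [|w ws IHws] t.
  by move=> /= -> _; exists [::]; rewrite ?big_nil.
move=> /= [v [t' [-> t'P]]] tU.
have PS : is_submod (fun x => forall v : V, tensors_over ws (pure v x)).
  split=> [v'|a x y xP yP v'].
    have -> : pure v' 0 = 0 :> tensor V W.
      have := pure_linearr v' (- 1) (0 : W) 0.
      by rewrite scaler0 addr0 scaleN1r addNr.
    exact: tensors_over0.
  by rewrite pure_linearr; apply: tensors_over_linear.
have [/submod_ofP wP|wP] := boolP (w \in submod_of PS).
  by apply: IHws tU; rewrite -[pure v w]scale1r; apply: tensors_over_linear.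
have [phi phiw phi0] := exists_functional wP.
have t'0 : slice phi t' = 0.
  have {phiw} wsP w' : w' \in ws -> phi w' = 0.
    by move=> w'ws; apply/phi0/submod_ofP => v'; apply: tensors_over_pure.
  elim: ws t' t'P wsP {IHws tU PS wP phi0} => [|w' ws IHws] t' /=.
    by move=> -> _; rewrite raddf0.
  move=> [v' [u [-> uP]]] wsP; rewrite linearD /= slice_pure wsP ?mem_head //.
  by rewrite scale0r add0r IHws // => x xws; apply: wsP; rewrite inE xws orbT.
have vU : v \in U.
  by have := tU phi; rewrite linearD /= slice_pure phiw scale1r t'0 addr0.
have [|s sU ->] := IHws t' t'P.
  move=> psi; have := rpredD (tU psi) (submodN (rpredZ (psi w) vU)).
  by rewrite linearD /= slice_pure addrAC subrr add0r.
exists ((v, w) :: s); last by rewrite big_cons.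
by move=> p; rewrite inE => /orP[/eqP ->|/sU].
Qed.

Lemma slice_inj V W (t : tensor V W) :
  (forall phi : {linear W -> k^o}, slice phi t = 0) -> t = 0.
Proof.
move=> t0; have ZS : is_submod (fun v : V => v = 0).
  by split=> // a x y -> ->; rewrite scaler0 addr0.
have [|s s0 ->] := @tensor_slices _ _ (submod_of ZS) t.
  by move=> phi; apply/submod_ofP.
by rewrite big_seq big1 // => p /s0/submod_ofP ->; rewrite pure0l.
Qed.

(** Slices commute with [f] and separate tensors. *)
Lemma tmap_inj V V' W (f : {linear V -> V'}) :
  injective f -> injective (tmap f (@id W)).
Proof.
move=> f_inj t u /eqP; rewrite -subr_eq0 => /eqP ftu.
apply/eqP; rewrite -subr_eq0; apply/eqP/slice_inj => phi.
have tB : tmap f (@id W) (t - u) = tmap f id t - tmap f id u.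
  by apply: (raddfB (mklinear (tmap_linear (g := @id W) (linearP f) _))).
by apply: f_inj; rewrite raddf0 -slice_tmapl tB ftu raddf0.
Qed.

Definition tensor_functional V W (psi : {linear V -> k^o})
    (phi : {linear W -> k^o}) : {linear tensor V W -> k^o} :=
  psi \o slice phi.

Lemma slice_slice V W X (psi : {linear W -> k^o}) (phi : {linear X -> k^o})
    (t : tensor (tensor V W) X) :
  slice psi (slice phi t) = slice (tensor_functional psi phi) (tassoc t).
Proof.
have aL : linear (slice (tensor_functional psi phi) \o @tassoc k V W X).
  by apply: comp_linear; [apply: tassoc_linear|apply: linearP].
have sL : linear (slice psi \o @slice (tensor V W) X phi) by exact: linearP.
apply: (tensor_ext sL aL) => u x.
have pL : linear (fun u : tensor V W => pure u x) := pure_linearl x.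
apply: (tensor_ext (comp_linear pL sL) (comp_linear pL aL)) => v w.
rewrite /= slice_pure tassoc_pure !slice_pure linearZ_LR /= slice_pure scalerA.
by rewrite /tensor_functional /= slice_pure linearZ_LR.
Qed.

(** All slices lie in the span of the left-hand factors of one expression of [t]; this is the source
    of local finiteness of comodules. *)
Lemma slice_finite V W (t : tensor V W) :
  exists n (f : {linear 'rV[k]_n -> V}),
    forall phi : {linear W -> k^o}, exists a, slice phi t = f a.
Proof.
have [s ->] := tensor_sum t; elim: s => [|[v w] s [n [f fP]]].
  by exists 0, \0 => phi; exists 0; rewrite big_nil raddf0.
have gL : linear (fun a : 'rV[k]_(1 + n) => lsubmx a 0 0 *: v + f (rsubmx a)).
  move=> c a b; have -> : rsubmx (c *: a + b) = c *: rsubmx a + rsubmx b.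
    exact: linearP.
  by rewrite (linearP f) !mxE scalerDl -scalerA scalerDr addrACA.
exists (1 + n)%N, (mklinear gL) => phi; have [a aP] := fP phi.
exists (row_mx (phi w)%:M a); rewrite /= row_mxKl row_mxKr big_cons linearD /=.
by rewrite slice_pure aP mxE eqxx.
Qed.

End Slices.

Section SubLmodule.
Context (k : fieldType) (V : lmodType k) (U : submodClosed V).

Record sublmod := Sublmod { sublmod_val :> V; _ : sublmod_val \in U }.

HB.instance Definition _ := [isSub for sublmod_val].
HB.instance Definition _ := [Choice of sublmod by <:].
HB.instance Definition _ := [SubChoice_isSubLmodule of sublmod by <:].

Lemma sublmod_val_linear : linear sublmod_val.
Proof. by []. Qed.

HB.instance Definition _ :=
  GRing.isLinear.Build k sublmod V *:%R sublmod_val sublmod_val_linear.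

Lemma sublmod_val_inj : injective sublmod_val.
Proof. exact: val_inj. Qed.

Lemma sublmodP (x : sublmod) : sublmod_val x \in U.
Proof. by case: x. Qed.

End SubLmodule.

(** * The action of the dual algebra, and coactions on stable subspaces *)

Section InducedComodule.
Context (k : fieldType) (C : coalgebra k) (M : comodule C).

(** The left action of the dual algebra, a sum of terms [phi m1 *: m0] in Sweedler notation. It
    determines the coaction, because slices separate tensors. *)
Definition act (phi : {linear C -> k^o}) (m : M) : M := slice phi (coact M m).

HB.instance Definition _ (phi : {linear C -> k^o}) :=
  GRing.Linear.copy (act phi) (slice phi \o coact M).

Lemma act_counit m : act (counit C) m = m.
Proof. exact: coact_counit. Qed.

(** The product of the dual algebra, which sends [c] to the sum of the [psi c1 * phi c2]. *)
Definition convolution (psi phi : {linear C -> k^o}) : {linear C -> k^o} :=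
  tensor_functional psi phi \o comul C.

Lemma act_act psi phi m : act psi (act phi m) = act (convolution psi phi) m.
Proof.
rewrite /act -(slice_tmapl (coact M)) slice_slice coactA slice_tmapr.
by [].
Qed.

Context (V : lmodType k) (i : {linear V -> M}).
Hypothesis i_inj : injective i.
Hypothesis i_act : forall phi v, exists v', act phi (i v) = i v'.

(** Stability under the action puts all slices of the coaction into the image of [i], so
    [tensor_slices] applies. *)
Lemma induced_coact_ex v : exists t, tmap i (@id C) t = coact M (i v).
Proof.
have IS : is_submod (fun m => exists v, m = i v).
  split=> [|a _ _ [x ->] [y ->]]; first by exists 0; rewrite raddf0.
  by exists (a *: x + y); rewrite linearP.
have [|s sI ->] := @tensor_slices _ _ _ (submod_of IS) (coact M (i v)).
  by move=> phi; apply/submod_ofP; exact: i_act.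
have tL : linear (tmap i (@id C)) by apply: tmap_linear => //; apply: linearP.
have : {in s, forall p, exists v, p.1 = i v} by move=> p /sI/submod_ofP.
elim: s {sI} => [|[m c] s IHs] sI.
  by exists 0; rewrite big_nil; apply: (raddf0 (mklinear tL)).
have [|t tE] := IHs; first by move=> p ps; apply: sI; rewrite inE ps orbT.
have [|v' /= ->] := sI (m, c); first exact: mem_head.
exists (pure v' c + t); rewrite big_cons -[pure v' c]scale1r tL tE !scale1r.
by rewrite tmap_pure //; apply: linearP.
Qed.

Definition induced_coact v := sval (cid (induced_coact_ex v)).

Lemma induced_coactE v : tmap i (@id C) (induced_coact v) = coact M (i v).
Proof. exact: svalP (cid (induced_coact_ex v)). Qed.

Lemma induced_coact_linear : linear induced_coact.
Proof.
move=> a x y; apply: (tmap_inj i_inj); rewrite tmap_linear //;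
  last exact: linearP.
by rewrite !induced_coactE !linearP.
Qed.

Definition induced_coact_lin := mklinear induced_coact_linear.

Lemma induced_coactA v :
  tassoc (tmap induced_coact_lin id (induced_coact_lin v)) =
  tmap id (comul C) (induced_coact_lin v).
Proof.
have [iL cL mL] : [/\ linear i, linear (coact M) & linear (comul C)].
  by split; apply: linearP.
have rL := induced_coact_linear.
have idC : linear (@id C) by [].
have idV : linear (@id V) by [].
have idM : linear (@id M) by [].
have tL : linear (tmap i (@id C)) by apply: tmap_linear.
(* Since [i] tensored with an identity is injective, coassociativity can be checked inside [M]. *)
apply: (tmap_inj i_inj); rewrite /=.
have id2 : @id (tensor C C) = tmap (@id C) (@id C).
  by apply/funext => t; rewrite tmap_id.
rewrite [in LHS]id2 -tassoc_tmap // tmap_comp //.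
have -> : tmap i id \o induced_coact = coact M \o i.
  by apply/funext => x; apply: induced_coactE.
rewrite -[in LHS](tmap_comp (g := @id C) (g' := @id C) iL cL) //.
rewrite induced_coactE coactA -induced_coactE !tmap_comp //.
Qed.

Lemma induced_counit v :
  tlift (fun m c => counit C c *: m) (induced_coact_lin v) = v.
Proof.
apply: i_inj; rewrite -[LHS](slice_tmapl i (counit C)) induced_coactE.
exact: act_counit.
Qed.

Definition induced_comodule : comodule C :=
  Comodule induced_coactA induced_counit.

Lemma induced_morphism :
    (i : V -> M) \in @comodule_morphism k C induced_comodule M.
Proof.
by apply/asboolP; split=> [|v]; [exact: linearP|rewrite /= induced_coactE].
Qed.

Definition induced_hom : comodule_hom induced_comodule M :=
  ComoduleHom induced_morphism.

End InducedComodule.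

(** * Comodules as modules over the dual of C *)

Section ComoduleTools.
Context (k : fieldType) (C : coalgebra k).
Implicit Types M N X Y S : comodule C.
Implicit Types phi : {linear C -> k^o}.

HB.instance Definition _ M N (f : comodule_hom M N) :=
  GRing.isLinear.Build k M N *:%R (comodule_fun f) (comodule_homP f).1.

Lemma hom_act M N (f : comodule_hom M N) phi m : f (act phi m) = act phi (f m).
Proof. by rewrite /act (comodule_homP f).2 slice_tmapl. Qed.

(** The two tensors to be compared have the same slices. *)
Lemma equivariant_morphism M N (f : {linear M -> N}) :
  (forall phi m, f (act phi m) = act phi (f m)) ->
  (f : M -> N) \in @comodule_morphism k C M N.
Proof.
move=> fA; apply/asboolP; split=> [|m]; first exact: linearP.
apply/eqP; rewrite -subr_eq0; apply/eqP/slice_inj => phi.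
by rewrite linearB /= slice_tmapl -[slice _ (coact M m)]/(act phi m) fA subrr.
Qed.

Definition equivariant_hom M N (f : {linear M -> N})
    (fA : forall phi m, f (act phi m) = act phi (f m)) : comodule_hom M N :=
  ComoduleHom (equivariant_morphism fA).

Lemma hom_eq0 M N (f : comodule_hom M N) : (forall x, f x = 0) -> f = 0.
Proof. by move=> f0; apply: comodule_hom_ext => x; rewrite f0. Qed.

Lemma hom_neq0 M N (f : comodule_hom M N) : f <> 0 -> exists x, f x != 0.
Proof.
move=> f0; have [//|nf] := pselect (exists x, f x != 0); case: f0.
by apply: hom_eq0 => x; apply/eqP/negPn/negP => fx; apply: nf; exists x.
Qed.

(* Keeps simplification from unfolding subobjects and quotients. *)
Fact comodule_key : unit. Proof. by []. Qed.

Lemma hom_inj_neq0 M N (f : comodule_hom M N) x :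
  injective f -> x != 0 -> f x != 0.
Proof. by move=> f_inj; apply: contra_neq => fx; apply: f_inj;
  rewrite fx raddf0. Qed.

(** Stability under the dual action is easier to verify than the condition on [coact], which
    [subcomod_coact] recovers. *)
Definition is_subcomod M (P : M -> Prop) : Prop :=
  is_submod P /\ forall phi x, P x -> P (act phi x).

Lemma subcomod_coact M (P : M -> Prop) (PS : is_subcomod P) m :
  m \in submod_of PS.1 ->
  exists2 s : seq (M * C), {in s, forall p, p.1 \in submod_of PS.1} &
    coact M m = \sum_(p <- s) pure p.1 p.2.
Proof.
move=> /submod_ofP mP; apply: tensor_slices => phi; apply/submod_ofP.
exact: PS.2.
Qed.

Definition subcomod_of M (P : M -> Prop) (PS : is_subcomod P) : subcomodule M :=
  locked_with comodule_key (Subcomodule (@subcomod_coact M P PS)).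

Lemma subcomod_ofP M (P : M -> Prop) (PS : is_subcomod P) x :
  x \in (subcomod_of PS : submodClosed M) <-> P x.
Proof. by rewrite /subcomod_of unlock; apply: submod_ofP. Qed.

Lemma act_sub M (N : subcomodule M) phi x :
  x \in (N : submodClosed M) -> act phi x \in (N : submodClosed M).
Proof.
move=> /coact_sub[s sN]; rewrite /act => ->.
rewrite linear_sum /= big_seq; apply: rpred_sum => p /sN pN.
by rewrite slice_pure rpredZ.
Qed.

Lemma ker_subcomod M N (f : comodule_hom M N) : is_subcomod (fun x => f x = 0).
Proof.
split; first split=> [|a x y fx fy]; rewrite ?raddf0 //.
  by rewrite linearP /= fx fy scaler0 addr0.
by move=> phi x fx; rewrite hom_act fx raddf0.
Qed.

Lemma joint_ker_subcomod M (A : Type) (N : A -> comodule C)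
    (f : forall a, comodule_hom M (N a)) :
  is_subcomod (fun x => forall a, f a x = 0).
Proof.
split; first split=> [a|c x y fx fy a].
- exact: raddf0.
- by rewrite linearP /= fx fy scaler0 addr0.
- by move=> phi x fx a; rewrite hom_act fx raddf0.
Qed.

Lemma all_ker_subcomod M (A : Type) (N : A -> comodule C)
    (f : forall a, comodule_hom M (N a)) (s : seq A) :
  is_subcomod (fun x => all (fun a => f a x == 0) s).
Proof.
elim: s => [|a s [[s0 sL] sA]] //=; split; first split=> [|c x y].
- by rewrite raddf0 eqxx s0.
- move=> /andP[/eqP fx xs] /andP[/eqP fy ys].
  by rewrite linearP /= fx fy scaler0 addr0 eqxx sL.
- by move=> phi x /andP[/eqP fx xs]; rewrite hom_act fx raddf0 eqxx sA.
Qed.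

Lemma preim_subcomod M N (f : comodule_hom M N) (P : subcomodule N) :
  is_subcomod (fun x => f x \in (P : submodClosed N)).
Proof.
split; first split=> [|a x y fx fy]; rewrite ?raddf0 ?rpred0 //.
  by rewrite linearP /= rpredD ?rpredZ.
by move=> phi x fx; rewrite hom_act act_sub.
Qed.

Lemma im_subcomod M N (f : comodule_hom M N) (P : subcomodule M) :
  is_subcomod (fun y => exists2 x, x \in (P : submodClosed M) & y = f x).
Proof.
split; first split=> [|a _ _ [x xP ->] [y yP ->]].
- by exists 0; rewrite ?rpred0 ?raddf0.
- by exists (a *: x + y); rewrite ?linearP ?rpredD ?rpredZ.
by move=> phi _ [x xP ->]; exists (act phi x); rewrite ?hom_act ?act_sub.
Qed.

Lemma range_subcomod M N (f : comodule_hom M N) :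
  is_subcomod (fun y => exists x, y = f x).
Proof.
split; first split=> [|a _ _ [x ->] [y ->]].
- by exists 0; rewrite ?raddf0.
- by exists (a *: x + y); rewrite ?linearP.
by move=> phi _ [x ->]; exists (act phi x); rewrite ?hom_act.
Qed.

Lemma orbit_subcomod M (m : M) : is_subcomod (fun x =>
  exists phi, x = act phi m).
Proof.
split; first split=> [|a _ _ [phi ->] [psi ->]].
- exists \0; apply/esym; rewrite /act.
  have [s ->] := tensor_sum (coact M m); rewrite linear_sum /= big1 // => p _.
  by rewrite slice_pure scale0r.
- exists (a \*: phi \+ psi); rewrite /act.
  have [s ->] := tensor_sum (coact M m); rewrite !linear_sum /= -big_split.
  by apply: eq_bigr => p _; rewrite /= !slice_pure scalerDl scalerA.
by move=> psi _ [phi ->]; exists (convolution psi phi); rewrite act_act.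
Qed.

Section SubComodule.
Context (M : comodule C) (N : subcomodule M).

Lemma sub_act phi (v : sublmod N) :
  exists v' : sublmod N, act phi (sublmod_val v) = sublmod_val v'.
Proof. by exists (Sublmod (act_sub phi (sublmodP v))). Qed.

Definition sub_comodule : comodule C :=
  induced_comodule (@sublmod_val_inj k M N) sub_act.

Definition sub_incl : comodule_hom sub_comodule M :=
  locked_with comodule_key (induced_hom (@sublmod_val_inj k M N) sub_act).

Lemma sub_inclE x : sub_incl x = sublmod_val x.
Proof. by rewrite /sub_incl unlock. Qed.

Lemma sub_incl_inj : injective sub_incl.
Proof. by move=> x y; rewrite !sub_inclE => /sublmod_val_inj. Qed.

Lemma sub_incl_in x : sub_incl x \in (N : submodClosed M).
Proof. by rewrite sub_inclE; apply: sublmodP. Qed.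

Lemma sub_incl_ex m : m \in (N : submodClosed M) -> exists x, m = sub_incl x.
Proof. by move=> mN; exists (Sublmod mN); rewrite sub_inclE. Qed.

Lemma quot_act phi m :
  quotmod_proj N (act phi m) =
    @act k C (quotient_comodule N) phi (quotmod_proj N m).
Proof.
have qE : coact (quotient_comodule N) (quotmod_proj N m) =
    tmap (quotmod_proj N) id (coact M m) by exact: quot_coact_proj.
by rewrite /act qE slice_tmapl.
Qed.

Definition quot_proj : comodule_hom M (quotient_comodule N) :=
  locked_with comodule_key
    (@equivariant_hom M (quotient_comodule N) (quotmod_proj N) quot_act).

Lemma quot_projE m : quot_proj m = quotmod_proj N m.
Proof. by rewrite /quot_proj unlock. Qed.

Lemma quot_proj_surj (q : quotient_comodule N) : exists m, q = quot_proj m.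
Proof. by exists (repr (q : quotmod N));
  rewrite quot_projE [RHS]quotmod_projK. Qed.

Lemma quot_proj_eq0 m : quot_proj m = 0 <-> m \in (N : submodClosed M).
Proof.
have p0 : (0 : quotient_comodule N) = quotmod_proj N 0 by rewrite raddf0.
rewrite quot_projE p0; split=> [/quotmod_projP|mN]; first by rewrite subr0.
by apply/quotmod_projP; rewrite subr0.
Qed.

End SubComodule.

Lemma quot_proj_eq M (N : subcomodule M) m m' :
  quot_proj N m = quot_proj N m' <-> m - m' \in (N : submodClosed M).
Proof.
rewrite -quot_proj_eq0 raddfB /=; split=> [->|/eqP]; first by rewrite subrr.
by rewrite subr_eq0 => /eqP.
Qed.

Lemma hom_lift_inj M N X (h : comodule_hom M N) (f : comodule_hom X N) :
  injective h -> (forall x, exists m, f x = h m) ->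
  exists g : comodule_hom X M, forall x, h (g x) = f x.
Proof.
move=> h_inj fh; pose g x := sval (cid (fh x)).
have gE x : h (g x) = f x by rewrite /g; case: cid.
have gL : linear g by move=> a x y; apply: h_inj; rewrite gE !linearP /= !gE.
have gA phi x : g (act phi x) = act phi (g x).
  by apply: h_inj; rewrite gE !hom_act gE.
by exists (@equivariant_hom X M (mklinear gL) gA).
Qed.

Lemma hom_lift_surj M N X (p : comodule_hom M N) (f : comodule_hom M X) :
  (forall n, exists m, n = p m) -> (forall m, p m = 0 -> f m = 0) ->
  exists g : comodule_hom N X, forall m, g (p m) = f m.
Proof.
move=> p_surj pf; pose s n := sval (cid (p_surj n)).
have sE n : p (s n) = n by rewrite /s; case: cid.
have fE m m' : p m = p m' -> f m = f m'.
  move=> pm; apply/eqP; rewrite -subr_eq0 -raddfB; apply/eqP/pf.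
  by rewrite raddfB /= pm subrr.
have gL : linear (f \o s).
  by move=> a x y; rewrite /= -linearP; apply: fE; rewrite linearP /= !sE.
have gA phi x : (f \o s) (act phi x) = act phi ((f \o s) x).
  by rewrite /= -hom_act; apply: fE; rewrite hom_act !sE.
exists (@equivariant_hom N X (mklinear gL) gA) => m.
by apply: fE; rewrite sE.
Qed.

Definition hom_post S M N (g : comodule_hom M N) (f : comodule_hom S M) :
  comodule_hom S N := comodule_comp g f.

Lemma hom_post_linear S M N (g : comodule_hom M N) : linear (@hom_post S M N g).
Proof.
move=> a f f'; apply: comodule_hom_ext => x.
by rewrite -[LHS]/(g (a *: f x + f' x)) linearP.
Qed.

HB.instance Definition _ S M N (g : comodule_hom M N) :=
  GRing.isLinear.Build k (comodule_hom S M) (comodule_hom S N) *:%R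
    (@hom_post S M N g) (@hom_post_linear S M N g).

Lemma hom_post_inj S M N (g : comodule_hom M N) :
  injective g -> injective (@hom_post S M N g).
Proof.
move=> g_inj f f' ff'; apply: comodule_hom_ext => x; apply: g_inj.
by rewrite -[LHS]/(hom_post g f x) ff'.
Qed.

Lemma simple_hom_inj S M (f : comodule_hom S M) :
  simple S -> f <> 0 -> injective f.
Proof.
move=> [_ S_simple] /hom_neq0[x fx]; apply: raddf_inj => y fy.
have [ker0|kerT] := S_simple (subcomod_of (ker_subcomod f)).
  by apply: ker0; apply/subcomod_ofP.
by have /subcomod_ofP fx0 := kerT x; rewrite fx0 eqxx in fx.
Qed.

Lemma orbit_cover M (m : M) : exists n (f : {linear 'rV[k]_n -> M}),
  forall phi, exists a, act phi m = f a.
Proof. exact: slice_finite. Qed.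

(** The orbit of a nonzero [x] contains [x], by the counit, so it is all of [S]; and orbits are
    finite-dimensional. *)
Lemma simple_finite_dimensional S : simple S -> finite_dimensional S.
Proof.
move=> [[x x0] S_simple]; have [n [f fP]] := orbit_cover x.
apply: (finite_dimensional_cover (f := f) (g := idfun)) => // y.
have [orb0|orbT] := S_simple (subcomod_of (orbit_subcomod x)).
  have xorb : x \in (subcomod_of (orbit_subcomod x) : submodClosed S).
    by apply/subcomod_ofP; exists (counit C); rewrite act_counit.
  by rewrite (orb0 _ xorb) eqxx in x0.
by have /subcomod_ofP[phi ->] := orbT y; apply: fP.
Qed.

(** Local finiteness of comodules: [F] is the orbit of [m]. *)
Lemma finite_dimensional_cyclic M (m : M) :
  exists F (i : comodule_hom F M),
    [/\ injective i, finite_dimensional F & exists x, i x = m].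
Proof.
pose N := subcomod_of (orbit_subcomod m); exists (sub_comodule N), (sub_incl N).
split; first exact: sub_incl_inj.
  have [n [f fP]] := orbit_cover m.
  apply: (finite_dimensional_cover (f := f) (g := sub_incl N)).
    exact: sub_incl_inj.
  move=> x; have /subcomod_ofP[phi phiE] := sub_incl_in x.
  by have [a aE] := fP phi; exists a; apply: etrans phiE aE.
have [|x xE] := @sub_incl_ex M N m; last by exists x.
by apply/subcomod_ofP; exists (counit C); rewrite act_counit.
Qed.

(** A minimal nonzero subcomodule of the finite-dimensional subcomodule generated by [m] is
    simple. *)
Lemma exists_simple M (m : M) : m != 0 ->
  exists S (s : comodule_hom S M), simple S /\ injective s.
Proof.
move=> m0; have [F [i [i_inj Ffd [x xm]]]] := finite_dimensional_cyclic m.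
pose P (U : submodClosed F) :=
  (exists N : subcomodule F, U = N) /\ exists2 y, y \in U & y != 0.
have [|U [[N UN] [y yU y0]] Umin] := finite_dimensional_minimal (P := P) Ffd.
  have FS : is_subcomod (fun _ : F => True) by [].
  exists (subcomod_of FS); split; first by eexists.
  exists x; first by apply/subcomod_ofP.
  by apply: contraNneq m0 => x0; rewrite -xm x0 raddf0.
subst U; exists (sub_comodule N), (comodule_comp i (sub_incl N)).
split; last exact: inj_comp i_inj (@sub_incl_inj F N).
split.
  have [z yz] := sub_incl_ex yU; exists z; apply: contraNneq y0 => z0.
  by rewrite yz z0 raddf0.
move=> W; pose W' := subcomod_of (im_subcomod (sub_incl N) W).
have [[w wW w0]|noW] :=
  pselect (exists2 w, w \in (W : submodClosed _) & w != 0); last first.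
  left=> w wW; apply/eqP/negPn/negP => w0; apply: noW; exists w => //.
right=> z; have NW' : {subset (N : submodClosed F) <= (W' : submodClosed F)}.
  apply: Umin; last by move=> u /subcomod_ofP[v _ ->]; apply: sub_incl_in.
  split; first by exists W'.
  exists (sub_incl N w); first by apply/subcomod_ofP; exists w.
  by apply: contraNneq w0 => /eqP; rewrite raddf_eq0 //; apply: sub_incl_inj.
have /NW'/subcomod_ofP[v vW /sub_incl_inj ->] := sub_incl_in z.
exact: vW.
Qed.

Lemma bijective_hom_inv M N (f : comodule_hom M N) : bijective f ->
  exists g : comodule_hom N M, cancel f g /\ cancel g f.
Proof.
move=> [g fK gK].
have gL : linear g by move=> a x y; apply: (can_inj fK); rewrite linearP /= !gK.
have gA phi x : g (act phi x) = act phi (g x).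
  by apply: (can_inj fK); rewrite hom_act !gK.
by exists (@equivariant_hom N M (mklinear gL) gA).
Qed.

Lemma finite_dimensional_hom_iso S S' M : isomorphic S S' ->
  finite_dimensional (comodule_hom S' M) ->
  finite_dimensional (comodule_hom S M).
Proof.
move=> [f /bijective_hom_inv[g [fK gK]]] S'fd.
pose pre (h : comodule_hom S M) : comodule_hom S' M := comodule_comp h g.
have preL : linear pre by move=> a h h'; apply: comodule_hom_ext.
apply: (finite_dimensional_sub (f := mklinear preL)) S'fd.
move=> h h' hh'; apply: comodule_hom_ext => x.
by have := congr1 (fun u : comodule_hom S' M => u (f x)) hh'; rewrite /= fK.
Qed.

End ComoduleTools.

(** * The regular comodule *)

Section RegularComodule.
Context (k : fieldType) (C : coalgebra k).
Implicit Types M N X Y S : comodule C.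

Lemma lslice_bilinear (V W : lmodType k) (lam : {linear V -> k^o}) :
  bilinear_for *:%R *:%R (fun (v : V) (w : W) => lam v *: w).
Proof.
split=> [w|v] a x y /=; first by rewrite linearP scalerDl scalerA.
by rewrite scalerDr !scalerA mulrC.
Qed.

(* lam (x) id *)
Definition lslice (V W : lmodType k) (lam : {linear V -> k^o})
    (t : tensor V W) : W :=
  tlift (fun v w => lam v *: w) t.

Arguments lslice {V W} lam t.

HB.instance Definition _ (V W : lmodType k) (lam : {linear V -> k^o}) :=
  GRing.isLinear.Build k (tensor V W) W *:%R (lslice lam)
    (tlift_linear (@lslice_bilinear V W lam)).

Lemma lslice_pure (V W : lmodType k) (lam : {linear V -> k^o}) (v : V) (w : W) :
  lslice lam (pure v w) = lam v *: w.
Proof. exact: (tlift_pure (@lslice_bilinear V W lam)). Qed.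

Lemma lslice_tmapl (V V' W : lmodType k) (f : {linear V -> V'})
    (lam : {linear V' -> k^o}) (t : tensor V W) :
  lslice lam (tmap f id t) = lslice (lam \o f) t.
Proof.
have fL : linear f by exact: linearP.
have idL : linear (@id W) by [].
have tL : linear (lslice lam \o tmap f (@id W)).
  by apply: comp_linear; [apply: tmap_linear|apply: linearP].
have sL : linear (@lslice V W (lam \o f)) by exact: linearP.
by apply: (tensor_ext tL sL) => v w; rewrite /= tmap_pure // !lslice_pure.
Qed.

Lemma lslice_tmapr (V W W' : lmodType k) (g : {linear W -> W'})
    (lam : {linear V -> k^o}) (t : tensor V W) :
  lslice lam (tmap id g t) = g (lslice lam t).
Proof.
have gL : linear g by exact: linearP.
have idL : linear (@id V) by [].
have tL : linear (lslice lam \o tmap (@id V) g).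
  by apply: comp_linear; [apply: tmap_linear|apply: linearP].
have sL : linear (g \o @lslice V W lam) by exact: linearP.
by apply: (tensor_ext tL sL) => v w;
  rewrite /= tmap_pure // !lslice_pure linearZ_LR.
Qed.

Lemma slice_lslice (V W X : lmodType k) (lam : {linear V -> k^o})
    (phi : {linear X -> k^o}) (t : tensor (tensor V W) X) :
  slice phi (lslice lam (tassoc t)) = lslice lam (slice phi t).
Proof.
have aL : linear (slice phi \o (lslice lam \o @tassoc k V W X)).
  apply: comp_linear; last exact: linearP.
  by apply: comp_linear; [apply: tassoc_linear|exact: linearP].
have sL : linear (@lslice V W lam \o slice phi) by exact: linearP.
apply: (tensor_ext aL sL) => u x.
have pL : linear (fun u : tensor V W => pure u x) := pure_linearl x.
apply: (tensor_ext (comp_linear pL aL) (comp_linear pL sL)) => v w.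
rewrite /= tassoc_pure !(slice_pure, lslice_pure, linearZ_LR) /=.
by rewrite !(slice_pure, lslice_pure) !scalerA mulrC.
Qed.

Lemma functional_lslice (V W : lmodType k) (lam : {linear V -> k^o})
    (psi : {linear W -> k^o}) (t : tensor V W) :
  psi (lslice lam t) = lam (slice psi t).
Proof.
have [aL sL] : linear (psi \o @lslice V W lam) /\ linear
  (lam \o @slice k V W psi).
  by split; exact: linearP.
apply: (tensor_ext aL sL) => v w.
by rewrite /= slice_pure lslice_pure !linearZ_LR; apply: mulrC.
Qed.

(* Com(M, C) is the dual space of M: a functional lam corresponds to
   (lam (x) id) o coact, and a morphism f to counit o f. *)
Lemma regular_hom_act M (lam : {linear M -> k^o}) (phi : {linear C -> k^o}) m :
  lslice lam (coact M (act phi m)) =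
  @act k C (regular_comodule C) phi (lslice lam (coact M m)).
Proof.
rewrite /act -(slice_tmapl (coact M)) -slice_lslice coactA.
by rewrite (lslice_tmapr (comul C)).
Qed.

Definition regular_hom M (lam : {linear M -> k^o}) :
    comodule_hom M (regular_comodule C) :=
  @equivariant_hom k C M (regular_comodule C) (lslice lam \o coact M)
    (regular_hom_act lam).

Lemma counit_regular_hom M (lam : {linear M -> k^o}) m :
  counit C (regular_hom lam m) = lam m.
Proof.
by rewrite -[regular_hom lam m]/(lslice lam (coact M m)) functional_lslice
  -{2}[m]act_counit.
Qed.

Definition counit_comp M (f : comodule_hom M (regular_comodule C)) :
    {linear M -> k^o} :=
  (counit C : {linear regular_comodule C -> k^o}) \o f.

Lemma regular_homE M (f : comodule_hom M (regular_comodule C)) m :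
  f m = lslice (counit_comp f) (coact M m).
Proof.
rewrite -[LHS](@counitl k C (f m)).
rewrite -[comul C (f m)]/(coact (regular_comodule C) (f m)) (comodule_homP f).2.
exact: (lslice_tmapl f (counit C)).
Qed.

(** Com(M, C) is the dual space of M, so extending a morphism amounts to extending a functional. *)
Lemma regular_injective : injective_comodule (regular_comodule C).
Proof.
move=> X Y i i_inj f.
have [lam lamE] := extend_functional (i := i) (counit_comp f) i_inj.
exists (regular_hom lam) => x.
rewrite -[LHS]/(lslice lam (coact Y (i x))) (comodule_homP i).2.
rewrite (lslice_tmapl i) regular_homE.
have [aL sL] : linear (@lslice X C (lam \o i)) /\
    linear (@lslice X C (counit_comp f)) by split; exact: linearP.
by apply: (tensor_ext aL sL) => v w; rewrite !lslice_pure -lamE.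
Qed.

Lemma regular_hom_eq0 M (f : comodule_hom M (regular_comodule C)) :
  (forall m, counit C (f m) = 0) -> f = 0.
Proof.
move=> f0; apply: hom_eq0 => m; rewrite regular_homE.
have [s ->] := tensor_sum (coact M m); rewrite linear_sum /= big1 // => p _.
by rewrite lslice_pure /counit_comp /= f0 scale0r.
Qed.

(** Com(S, C) is the dual of the finite-dimensional space [S]; the embedding evaluates the
    functional of [f] on a basis of [S]. *)
Lemma regular_quasi_finite : quasi_finite (regular_comodule C).
Proof.
move=> S /simple_finite_dimensional[n [[v2r vL [r2v vK rK]]]].
have rL : linear (fun f : comodule_hom S (regular_comodule C) =>
    \row_j counit C (f (r2v (delta_mx 0 j)))).
  move=> a f g; apply/rowP => j; rewrite !mxE.
  by rewrite -[(a *: f + g) _]/(a *: f _ + g _) linearP.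
apply: (@finite_dimensional_inj _ _ _ (mklinear rL));
  apply: raddf_inj => f /rowP f0.
apply: regular_hom_eq0 => m; rewrite -(vK m).
have r2vL : linear r2v by move=> a x y; apply: (can_inj vK); rewrite vL !rK.
pose L : {linear 'rV[k]_n -> k^o} := counit_comp f \o mklinear r2vL.
have L0 j : L (delta_mx 0 j) = 0 by have := f0 j; rewrite !mxE.
rewrite -[LHS]/(L (v2r m)) [v2r m]row_sum_delta linear_sum big1 // => j _.
by rewrite linearZ_LR L0 scaler0.
Qed.

Lemma simple_embeds_regular S : simple S ->
  exists f : comodule_hom S (regular_comodule C), injective f.
Proof.
move=> S_simple; have [[x x0] _] := S_simple.
have ZS : is_submod (fun v : S => v = 0).
  by split=> // a u v -> ->; rewrite scaler0 addr0.
have [|lam lamx _] := @exists_functional _ _ (submod_of ZS) x.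
  by apply/negP => /submod_ofP xE; rewrite xE eqxx in x0.
exists (regular_hom lam); apply: simple_hom_inj => // f0.
have := counit_regular_hom lam x; rewrite f0 raddf0 lamx => /esym/eqP.
by rewrite oner_eq0.
Qed.

End RegularComodule.

(** * Quasi-finiteness at a simple comodule *)

Section SerreClasses.
Context (k : fieldType) (C : coalgebra k).
Implicit Types A B D M N X S E : comodule C.

Definition quasi_finite_at S M : Prop :=
  forall N : subcomodule M,
    finite_dimensional (comodule_hom S (quotient_comodule N)).

(** For a subcomodule [N] of [B], the quotient of [A] by the preimage of [N] embeds in B/N with
    image containing the kernel of the map from B/N to the quotient of [D] by the image of [N].
    Com(S, -) is left exact. *)
Lemma quasi_finite_at_ext S A B D (i : comodule_hom A B)
    (p : comodule_hom B D) :
  (forall b, p b = 0 -> exists a, b = i a) ->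
  quasi_finite_at S A -> quasi_finite_at S D -> quasi_finite_at S B.
Proof.
move=> exact_ip Afd Dfd N.
pose NA := subcomod_of (preim_subcomod i N).
pose ND := subcomod_of (im_subcomod p N).
have [|a aE] := @hom_lift_surj _ _ _ _ _ (quot_proj NA)
    (comodule_comp (quot_proj N) i) (@quot_proj_surj _ _ _ NA).
  by move=> x /quot_proj_eq0/subcomod_ofP xN; apply/quot_proj_eq0.
have [|b bE] := @hom_lift_surj _ _ _ _ _ (quot_proj N)
    (comodule_comp (quot_proj ND) p) (@quot_proj_surj _ _ _ N).
  move=> x /quot_proj_eq0 xN; apply/quot_proj_eq0/subcomod_ofP.
  by exists x.
have a_inj : injective a.
  apply: raddf_inj => q; have [x ->] := quot_proj_surj q.
  by rewrite /= aE => /quot_proj_eq0 ixN; apply/quot_proj_eq0/subcomod_ofP.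
apply: (@finite_dimensional_ext _ _ _ _ (@hom_post _ _ S _ _ a)
          (@hom_post _ _ S _ _ b)) (Afd NA) (Dfd ND).
  exact: hom_post_inj.
move=> w bw0; have wa s : exists q, w s = a q.
  have [x wx] := quot_proj_surj (w s).
  have : b (w s) = 0 by rewrite -[LHS]/(hom_post b w s) bw0.
  rewrite wx bE => /quot_proj_eq0/subcomod_ofP[y yN pxy].
  have [|z zE] := exact_ip (x - y); first by rewrite raddfB /= pxy subrr.
  exists (quot_proj NA z); rewrite aE; apply/quot_proj_eq.
  by rewrite -zE opprB addrC subrK.
have [v vE] := hom_lift_inj a_inj wa.
by exists v; apply: comodule_hom_ext => s; rewrite -vE.
Qed.

Lemma torsion_eq0 E M (f : comodule_hom M E) x : torsion E M -> f x = 0.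
Proof. by move=> /(_ f) ->. Qed.

(** A map from [B] to [E] vanishes on the image of [i], so it factors through B modulo the kernel of
    [p]. This quotient embeds in [D], and injectivity of [E] extends the map to [D], where it is
    zero. *)
Lemma torsion_ext E A B D (i : comodule_hom A B) (p : comodule_hom B D) :
  injective_comodule E -> (forall b, p b = 0 -> exists a, b = i a) ->
  torsion E A -> torsion E D -> torsion E B.
Proof.
move=> E_inj exact_ip tA tD f.
pose K := subcomod_of (ker_subcomod p).
have fi a : f (i a) = 0 := torsion_eq0 (comodule_comp f i) a tA.
have [|g gE] := @hom_lift_surj _ _ _ _ _ (quot_proj K) f
  (@quot_proj_surj _ _ _ K).
  by move=> b /quot_proj_eq0/subcomod_ofP/exact_ip[a ->].
have [|q qE] := @hom_lift_surj _ _ _ _ _ (quot_proj K) p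
  (@quot_proj_surj _ _ _ K).
  by move=> b /quot_proj_eq0/subcomod_ofP.
have q_inj : injective q.
  apply: raddf_inj => u; have [x ->] := quot_proj_surj u.
  by rewrite /= qE => px; apply/quot_proj_eq0/subcomod_ofP.
have [h hE] := E_inj _ _ q q_inj g.
by apply: hom_eq0 => b; rewrite -gE -hE; apply: torsion_eq0.
Qed.

(** The condition says that the kernel of [p] lies in the image of [i]; this single closure property
    yields subobjects, quotients and extensions by padding with zero comodules. *)
Definition serre_class (Q : comodule C -> Prop) : Prop :=
  (forall M, (forall x : M, x = 0) -> Q M) /\
  forall A B D (i : comodule_hom A B) (p : comodule_hom B D),
    (forall b, p b = 0 -> exists a, b = i a) -> Q A -> Q D -> Q B.

Lemma serre_torsion E : injective_comodule E -> serre_class (torsion E).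
Proof.
move=> E_inj; split=> [M M0 f|A B D i p]; last exact: torsion_ext.
by apply: hom_eq0 => x; rewrite (M0 x) raddf0.
Qed.

Lemma serre_quasi_finite_at S : serre_class (quasi_finite_at S).
Proof.
split=> [M M0 N|A B D i p]; last exact: quasi_finite_at_ext.
apply: finite_dimensional0 => f; apply: hom_eq0 => x.
by have [y ->] := quot_proj_surj (f x); rewrite (M0 y) raddf0.
Qed.

Section SerreTheory.
Context (Q : comodule C -> Prop) (Q_serre : serre_class Q).

Let zero_comodule M : comodule C :=
  quotient_comodule (subcomod_of (ker_subcomod (0 : comodule_hom M M))).

Let zero_comoduleP M (x : zero_comodule M) : x = 0.
Proof. by have [m ->] := quot_proj_surj x;
  apply/quot_proj_eq0/subcomod_ofP. Qed.

Lemma serre_sub A B (i : comodule_hom A B) : injective i -> Q B -> Q A.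
Proof.
move=> i_inj; apply: (Q_serre.2 (zero_comodule A) _ _ 0 i).
  by move=> a ia; exists 0; rewrite raddf0; apply: i_inj; rewrite ia raddf0.
by apply: Q_serre.1; apply: zero_comoduleP.
Qed.

Lemma serre_quot A B (p : comodule_hom A B) :
  (forall b, exists a, b = p a) -> Q A -> Q B.
Proof.
move=> p_surj QA; apply: (Q_serre.2 _ _ (zero_comodule B) p 0) => //.
by apply: Q_serre.1; apply: zero_comoduleP.
Qed.

Lemma serre_family M (J : Type) (D : J -> comodule C)
    (f : forall j, comodule_hom M (D j)) (s : seq J) (K : subcomodule M) :
  (forall j, Q (D j)) ->
  (forall x, all (fun j => f j x == 0) s -> x \in (K : submodClosed M)) ->
  Q (sub_comodule K) -> Q M.
Proof.
move=> Dfd.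
(* Generalizing to subcomodules [L] lets the induction replace [L] by its intersection with the
   kernel of one map of the list. *)
suff step (L : subcomodule M) :
    (forall x, x \in (L : submodClosed M) -> all (fun j => f j x == 0) s ->
       x \in (K : submodClosed M)) ->
    Q (sub_comodule K) -> Q (sub_comodule L).
  move=> sK Kfd; have TS : is_subcomod (fun _ : M => True) by [].
  apply: (@serre_quot (sub_comodule (subcomod_of TS)) M (sub_incl _)).
    by move=> m; apply: sub_incl_ex; apply/subcomod_ofP.
  by apply: step => // x _; apply: sK.
elim: s L => [|j s IHs] L sK Kfd.
  have [|h hE] := @hom_lift_inj _ _ _ _ _ (sub_incl K) (sub_incl L)
    (@sub_incl_inj _ _ _ K).
    by move=> x; apply/sub_incl_ex/sK => //; apply: sub_incl_in.
  apply: (serre_sub (i := h)) Kfd.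
  by move=> x y hxy; apply: (@sub_incl_inj _ _ _ L); rewrite -!hE hxy.
have LjS : is_subcomod (fun x => x \in (L : submodClosed M) /\ f j x = 0).
  have [[p0 pL] pA] := ker_subcomod (f j).
  split; first split=> [|a x y [xL fx] [yL fy]].
  - by rewrite rpred0.
  - by split; [rewrite rpredD ?rpredZ|apply: pL].
  - by move=> phi x [xL fx]; split; [apply: act_sub|apply: pA].
pose Lj := subcomod_of LjS.
have [|h hE] := @hom_lift_inj _ _ _ _ _ (sub_incl L) (sub_incl Lj)
  (@sub_incl_inj _ _ _ L).
  by move=> x; apply/sub_incl_ex; have /subcomod_ofP[] := sub_incl_in x.
apply: (Q_serre.2 _ _ _ h (comodule_comp (f j) (sub_incl L))).
- move=> b fb; have [|a aE] := @sub_incl_ex _ _ _ Lj (sub_incl L b).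
    by apply/subcomod_ofP; split=> //; apply: sub_incl_in.
  by exists a; apply: (@sub_incl_inj _ _ _ L); rewrite hE.
- apply: IHs => // x /subcomod_ofP[xL fx] xs.
  by apply: sK => //=; rewrite fx eqxx.
- exact: Dfd.
Qed.

End SerreTheory.

Lemma all_forall (T A : Type) (p : T -> pred A) (s : seq A) :
  (forall z, all (p z) s) -> all (fun a => `[< forall z, p z a >]) s.
Proof.
elim: s => //= a s IHs ps; apply/andP; split.
  by apply/asboolP => z; have /andP[] := ps z.
by apply: IHs => z; have /andP[] := ps z.
Qed.

(** * The injective hull of a simple comodule *)

Section Hull.
Context (S E : comodule C) (iota : comodule_hom S E).
Hypotheses (S_simple : simple S) (hull : injective_hull iota).

Let E_inj : injective_comodule E := hull.1.
Let iota_inj : injective iota := hull.2.1.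

Lemma hull_extend M (f : comodule_hom S M) : f <> 0 ->
  exists g : comodule_hom M E, forall x, g (f x) = iota x.
Proof. by move=> f0; apply: E_inj; apply: simple_hom_inj. Qed.

Lemma hull_extend_neq0 M (f : comodule_hom S M) : f <> 0 ->
  exists (g : comodule_hom M E) x, g (f x) != 0.
Proof.
move=> /hull_extend[g gE]; have [[x x0] _] := S_simple; exists g, x.
by rewrite gE; apply: contraNneq x0 => /eqP; rewrite raddf_eq0.
Qed.

Lemma torsion_hom0 M (f : comodule_hom S M) : torsion E M -> f = 0.
Proof.
move=> tM; apply: contrapT => /hull_extend_neq0[g [x]].
by rewrite (torsion_eq0 g _ tM) eqxx.
Qed.

(** Quotients of torsion comodules are torsion, and a torsion comodule contains no copy of [S]. *)
Lemma torsion_quasi_finite_at M : torsion E M -> quasi_finite_at S M.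
Proof.
move=> tM N; apply: finite_dimensional0 => f; apply: torsion_hom0 => g.
apply: hom_eq0 => q; have [x ->] := quot_proj_surj q.
exact: (torsion_eq0 (comodule_comp g (quot_proj N))).
Qed.

Lemma hull_essential M (h : comodule_hom M E) : h <> 0 ->
  exists x m, iota x = h m /\ x != 0.
Proof.
move=> /hom_neq0[m hm].
have [|x /subcomod_ofP[m' xm'] x0] := hull.2.2 (subcomod_of (range_subcomod h)).
  by exists (h m) => //; apply/subcomod_ofP; exists m.
by exists x, m'.
Qed.

(** By essentiality the image of [h] meets that of [iota], hence contains it as [S] is simple; the
    resulting map from [S] to [S'] is onto as [S'] is simple. *)
Lemma simple_hull S' (h : comodule_hom S' E) : simple S' -> h <> 0 ->
  exists2 g : comodule_hom S S', bijective g & forall x, h (g x) = iota x.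
Proof.
move=> S'_simple h0; have h_inj := simple_hom_inj S'_simple h0.
have [x [m [xm x0]]] := hull_essential h0.
have [|g gE] := @hom_lift_inj _ _ _ _ _ h iota h_inj.
  move=> y; pose P := subcomod_of
    (preim_subcomod iota (subcomod_of (range_subcomod h))).
  have [P0|PT] := S_simple.2 P.
    have xP : x \in (P : submodClosed S).
      by apply/subcomod_ofP/subcomod_ofP; exists m.
    by rewrite (P0 _ xP) eqxx in x0.
  by have /subcomod_ofP/subcomod_ofP := PT y.
exists g => //; have g_surj y : exists z, y = g z.
  have [P0|PT] := S'_simple.2 (subcomod_of (range_subcomod g)).
    have gxP : g x \in (subcomod_of (range_subcomod g) : submodClosed S').
      by apply/subcomod_ofP; exists x.
    move: x0; have := gE x; rewrite (P0 _ gxP) raddf0 => /esym/eqP.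
    by rewrite raddf_eq0 // => ->.
  by have /subcomod_ofP := PT y.
exists (fun y => sval (cid (g_surj y))) => [z|y]; case: cid => z' //= zE.
by apply: iota_inj; rewrite -!gE zE.
Qed.

(** Every morphism from [S] to [E] lands in the copy of [S], so evaluation at a nonzero [x] embeds
    Com(S, E) into the finite-dimensional [S]. *)
Lemma finite_dimensional_hom_hull : finite_dimensional (comodule_hom S E).
Proof.
have [[x x0] _] := S_simple.
have simple_range (f : comodule_hom S E) : exists y, f x = iota y.
  have [->|f0] := pselect (f = 0); first by exists 0; rewrite raddf0.
  have [g [gi gK iK] gE] := simple_hull S_simple f0.
  by exists (gi x); rewrite -gE iK.
pose e f := sval (cid (simple_range f)).
have eE f : iota (e f) = f x by rewrite /e; case: cid.
have eL : linear e by move=> a f g; apply: iota_inj; rewrite linearP /= !eE.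
apply: (finite_dimensional_sub (f :=
  mklinear eL)) (simple_finite_dimensional S_simple).
apply: raddf_inj => f /= ef0; apply: contrapT => f0.
have := eE f; rewrite ef0 raddf0 => /esym/eqP; rewrite raddf_eq0 => [x0'|].
  by rewrite x0' in x0.
exact: simple_hom_inj.
Qed.

(* The maps psi_a induce an embedding of X/N into a product of copies of E, N
   being their common kernel; so every simple subcomodule of X/N is isomorphic
   to S, and N is cut out as soon as the finite-dimensional space Com(S, X/N) is
   separated. *)
Lemma quasi_finite_at_subfamily X (A : Type) (psi : A -> comodule_hom X E) :
  quasi_finite_at S X ->
  exists s : seq A, forall x, all (fun a =>
    psi a x == 0) s -> forall a, psi a x = 0.
Proof.
move=> Xfd.
pose N := subcomod_of (joint_ker_subcomod psi).
have /choice[psi' psi'E] a : exists g : comodule_hom (quotient_comodule N) E,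
    forall x, g (quot_proj N x) = psi a x.
  apply: hom_lift_surj; first exact: quot_proj_surj.
  by move=> x /quot_proj_eq0/subcomod_ofP.
have joint0 q : (forall a, psi' a q = 0) -> q = 0.
  have [x ->] := quot_proj_surj q => q0; apply/quot_proj_eq0/subcomod_ofP => a.
  by rewrite -psi'E.
have kerS a : is_submod (fun f : comodule_hom S (quotient_comodule N) =>
    hom_post (psi' a) f = 0).
  by split=> [|c f g f0 g0]; rewrite ?raddf0 // linearP /= f0 g0 scaler0 addr0.
have [s sP] := finite_subfamily (fun a => submod_of (kerS a)) (Xfd N).
exists s => x xs; pose P := fun q => all (fun a => psi' a q == 0) s.
pose K := subcomod_of (all_ker_subcomod psi' s).
(* A simple subcomodule of [K] is detected by some [psi' a], so it is a copy of [S]. The resulting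
   element of Com(S, X/N) is killed by the maps in [s], hence by [psi' a], a contradiction. *)
have K0 q : P q -> q = 0.
  move=> qP; apply/eqP/negPn/negP => q0.
  have [|y yE] := @sub_incl_ex _ _ _ K q; first exact/subcomod_ofP.
  have [|S' [s' [S'_simple s'_inj]]] := @exists_simple _ _ (sub_comodule K) y.
    by apply: contraNneq q0 => y0; rewrite yE y0 raddf0.
  pose t := comodule_comp (sub_incl K) s'.
  have [x' x'0] := S'_simple.1.
  have tx' : t x' != 0.
    apply: contraNneq x'0 => /eqP.
    by rewrite raddf_eq0 //; apply: inj_comp => //; apply: sub_incl_inj.
  have [a atx] : exists a, psi' a (t x') != 0.
    apply: contrapT => na; move: tx'; rewrite (joint0 (t x')) ?eqxx // => a.
    by apply/eqP/negPn/negP => nz; apply: na; exists a.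
  have [|g [gi gK iK] gE] :=
    @simple_hull _ (comodule_comp (psi' a) t) S'_simple.
    by move=> h0; move: atx;
      rewrite -[psi' a _]/(comodule_comp (psi' a) t x') h0 eqxx.
  have tg_all z : all (fun b => psi' b (t (g z)) == 0) s.
    by have /subcomod_ofP := sub_incl_in (s' (g z)).
  have /sP/(_ a)/submod_ofP tg0 :
      all (fun b => comodule_comp t g \in submod_of (kerS b)) s.
    apply: sub_all (all_forall tg_all) => b /asboolP b0; apply/submod_ofP.
    by apply: hom_eq0 => z; apply/eqP/b0.
  move: atx; rewrite -(iK x') -[psi' a
    _]/(hom_post (psi' a) (comodule_comp t g) _).
  by rewrite tg0 eqxx.
move=> a; rewrite -psi'E (K0 (quot_proj N x)) ?raddf0 // /P.
by rewrite (eq_all (a2 := fun b => psi b x == 0)) // => b; rewrite psi'E.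
Qed.

End Hull.
End SerreClasses.

(** [T] is a bare type, so the enumerating list is obtained over [{classic T}]. *)
Lemma finite_set_all (T : Type) (A : set T) : finite_set A ->
  exists s : seq T, forall p : pred T, all p s -> forall x, A x -> p x.
Proof.
move=> Afin; have /finite_seqP[s sE] : finite_set (A : set {classic T}) by [].
exists (s : seq T) => p /(@allP {classic T} p s) ps x; rewrite sE; exact: ps.
Qed.

(** * Injective hulls of the simple comodules *)

Section Hulls.
Context (k : fieldType) (C : coalgebra k) (I : Type) (S : I -> comodule C).
Context (hS : simple_representatives S) (E : I -> comodule C).
Context (iota : forall i : I, comodule_hom (S i) (E i)).
Context (hE : forall i : I, injective_hull (iota i)).
Implicit Types M N K F : comodule C.

Let S_simple i : simple (S i). Proof. by have [] := hS. Qed.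

Lemma strictly_quasi_finiteP M :
  strictly_quasi_finite M <-> forall i, quasi_finite_at (S i) M.
Proof.
split=> [Mfd i N|Mfd N S' S'_simple]; first exact: Mfd.
have [_ _ repr] := hS; have [i S'i] := repr _ S'_simple.
exact: finite_dimensional_hom_iso S'i (Mfd i N).
Qed.

Lemma exists_socle_hom M (m : M) : m != 0 ->
  exists i (f : comodule_hom (S i) M), f <> 0.
Proof.
move=> m0; have [S' [s [S'_simple s_inj]]] := exists_simple m0.
have [_ _ repr] := hS.
have [i [f /bijective_hom_inv[g [fK gK]]]] := repr _ S'_simple.
exists i, (comodule_comp s g) => sg0.
have [[x x0] _] := S'_simple.
have : s (g (f x)) = 0.
  exact: (congr1 (fun h : comodule_hom (S i) M => h (f x)) sg0).
by rewrite fK => /eqP; rewrite raddf_eq0 // (negbTE x0).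
Qed.

(** By local finiteness it suffices to treat a finite-dimensional [F] embedded in [K]. Its simple
    subcomodules are of type [S j] with [j] outside [J], so finitely many maps to such [E j] embed
    [F] into a finite product of torsion comodules. *)
Lemma separated_socle_torsion E0 (J : set I) : injective_comodule E0 ->
  (forall j, ~ J j -> torsion E0 (E j)) ->
  forall K, (forall j, J j -> forall f : comodule_hom (S j) K, f = 0) ->
  torsion E0 K.
Proof.
move=> E0_inj JT K K0 f; apply: hom_eq0 => x.
have [F [i [i_inj Ffd [y <-]]]] := finite_dimensional_cyclic x.
suff tF : torsion E0 F by exact: (torsion_eq0 (comodule_comp f i)).
pose A := {j : I & {h : comodule_hom F (E j) | ~ J j}}.
pose D (a : A) := E (tag a);
  pose g (a : A) : comodule_hom F (D a) := sval (tagged a).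
have [s sP] := finite_subfamily (fun a => subcomod_of (ker_subcomod (g a))) Ffd.
(* The zero subcomodule, as the kernel of the identity. *)
pose Z := subcomod_of (ker_subcomod (@comodule_idm k C F)).
apply: (serre_family (serre_torsion E0_inj) (f := g) (s := s) (K := Z)).
- by move=> a; apply: JT; apply: (svalP (tagged a)).
- move=> z zs; apply/subcomod_ofP => /=; apply/eqP/negPn/negP => z0.
  pose G := subcomod_of (joint_ker_subcomod g).
  have [|z' zE] := @sub_incl_ex _ _ _ G z.
    have zD : all (fun b =>
      z \in (subcomod_of (ker_subcomod (g b)) : submodClosed F)) s.
      by apply: sub_all zs => b /eqP bz; apply/subcomod_ofP.
    by apply/subcomod_ofP => a; have /subcomod_ofP := sP z zD a.
  have [|j [h h0]] := @exists_socle_hom (sub_comodule G) z'.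
    by apply: contraNneq z0 => z'0; rewrite zE z'0 raddf0.
  pose t := comodule_comp (sub_incl G) h.
  have t0 : t <> 0.
    by move=> t0; apply: h0; apply: (hom_post_inj (@sub_incl_inj _ _ _ G));
      rewrite raddf0.
  have [Jj|nJj] := pselect (J j).
    apply: t0; apply: (hom_post_inj i_inj); rewrite raddf0.
    exact: K0.
  have [u [w uw]] := hull_extend_neq0 (S_simple j) (hE j) t0.
  pose a : A := existT _ j (exist _ u nJj).
  have /subcomod_ofP/(_ a) := sub_incl_in (h w).
  by move=> gw; move: uw; rewrite -[u _]/(g a (sub_incl G (h w))) gw eqxx.
- apply: (serre_torsion E0_inj).1 => z; apply: (@sub_incl_inj _ _ _ Z).
  by have /subcomod_ofP /= -> := sub_incl_in z; rewrite raddf0.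
Qed.

Lemma quasi_finite_quasi_finite_at i0 (J : set I) M :
  finite_set J -> (forall j, ~ J j -> torsion (E i0) (E j)) ->
  (forall j, quasi_finite_at (S i0) (E j)) ->
  quasi_finite M -> quasi_finite_at (S i0) M.
Proof.
move=> /finite_set_all[js jsP] JT Efd Mfd.
pose A := {j : I & comodule_hom M (E j)}.
pose D (a : A) := E (tag a); pose g (a : A) : comodule_hom M (D a) := tagged a.
(* The maps in [s] separate Com(S j, M). This persists when [s] grows, so lists found for the single
   [j] can be concatenated. *)
pose sep (s : seq A) (j : I) := `[< forall h : comodule_hom (S j) M,
  all (fun a => comodule_comp (g a) h == 0) s -> h = 0 >].
have [s sP] : exists s, all (sep s) js.
  elim: js {jsP} => [|j js [s sP]]; first by exists [::].
  have kerS (f : comodule_hom M (E j)) :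
      is_submod (fun h : comodule_hom (S j) M => hom_post f h = 0).
    split=> [|c u v uf vf]; first by rewrite raddf0.
    by rewrite linearP /= uf vf scaler0 addr0.
  have [r rP] := finite_subfamily (fun f =>
    submod_of (kerS f)) (Mfd _ (S_simple j)).
  exists (map (Tagged (fun j => comodule_hom M (E j))) r ++ s) => /=.
  apply/andP; split.
    apply/asboolP => h; rewrite all_cat all_map => /andP[hr _].
    apply: contrapT => /(hull_extend_neq0 (S_simple j) (hE j))[f [x]].
    have hD : all (fun f => h \in submod_of (kerS f)) r.
      by apply: sub_all hr => b /eqP bh; apply/submod_ofP.
    have /submod_ofP fh := rP h hD f.
    by rewrite -[f _]/(hom_post f h x) fh eqxx.
  apply: sub_all sP => l /asboolP lP; apply/asboolP => h.
  by rewrite all_cat => /andP[_ /lP].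
pose K := subcomod_of (all_ker_subcomod g s).
apply: (serre_family (serre_quasi_finite_at (S i0)) (f := g) (s := s) (K := K)).
- by move=> a; apply: Efd.
- by move=> x xs; apply/subcomod_ofP.
apply: (torsion_quasi_finite_at (S_simple i0) (hE i0)).
apply: (separated_socle_torsion (hE i0).1 JT) => j Jj f.
apply: (hom_post_inj (@sub_incl_inj _ _ _ K)); rewrite raddf0.
have /asboolP := jsP _ sP j Jj; apply.
have Kall x : all (fun a => g a (sub_incl K (f x)) == 0) s.
  by have /subcomod_ofP := sub_incl_in (f x).
apply: sub_all (all_forall Kall) => a /asboolP a0.
by apply/eqP; apply: hom_eq0 => x; apply/eqP/a0.
Qed.

(** A map that is nonzero on the essential simple subcomodule is injective, and [E i] is
    injective. *)
Lemma hull_split i X (g : comodule_hom (E i) X) :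
  comodule_comp g (iota i) <> 0 -> exists r :
    comodule_hom X (E i), forall y, r (g y) = y.
Proof.
move=> gi0; have [E_inj [i_inj ess]] := hE i.
have gi_inj := simple_hom_inj (S_simple i) gi0.
apply: (E_inj _ _ g _ (comodule_idm (E i))).
apply: raddf_inj => y gy; apply/eqP/negPn/negP => y0.
have [|x /subcomod_ofP gx x0] := ess (subcomod_of (ker_subcomod g)).
  by exists y => //; apply/subcomod_ofP.
by have := hom_inj_neq0 gi_inj x0; rewrite /= gx eqxx.
Qed.

Lemma simple_embeds_regular_neq0 i :
  exists f : comodule_hom (S i) (regular_comodule C), f <> 0.
Proof.
have [f f_inj] := simple_embeds_regular (S_simple i); exists f => f0.
have [[x x0] _] := S_simple i.
by have := hom_inj_neq0 f_inj x0; rewrite f0 eqxx.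
Qed.

(** An embedding of [S i] into C extends to [E i] because C is injective, and the extension
    splits. *)
Lemma hull_quotient_regular i : exists p :
  comodule_hom (regular_comodule C) (E i),
  forall y, exists c, y = p c.
Proof.
have [f f0] := simple_embeds_regular_neq0 i.
have [g gE] := @regular_injective _ C _ _ (iota i) (hE i).2.1 f.
have [|r rg] := @hull_split i _ g; last by exists r => y; exists (g y).
by move=> gi0; apply: f0; rewrite -gi0; apply: comodule_hom_ext => x;
  rewrite -gE.
Qed.

Lemma hom_hull_distinct i j (f : comodule_hom (S i) (E j)) : i <> j -> f = 0.
Proof.
move=> ij; apply: contrapT => f0; apply: ij.
have [g g_bij _] := simple_hull (S_simple j) (hE j) (S_simple i) f0.
have [_ inj _] := hS; apply/esym/inj; first by exists g.
Qed.

(* A sequence of pairwise orthogonal idempotents of C with images E (j n), j n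
   distinct, would provide infinitely many independent maps C -> E i0. *)
Lemma nontorsion_hulls_finite i0 :
  quasi_finite_at (S i0) (regular_comodule C) ->
  finite_set [set j | ~ torsion (E i0) (E j)]%classic.
Proof.
set J := [set j | _]%classic => Cfd; apply: contrapT => Jinf.
pose R := regular_comodule C.
(* The [j] in [J] for which the image of [e] has no copy of [S j] left. Each construction step uses
   up at most one further index, so it never gets stuck. *)
pose exhausted (e : comodule_hom R R) := [set j | J j /\
  forall f : comodule_hom (S j) R, (forall x, e (f x) = f x) -> f = 0]%classic.
pose good (e : comodule_hom R R) :=
  (forall x, e (e x) = e x) /\ finite_set (exhausted e).
have good1 : good (comodule_idm R).
  split=> //; rewrite (_ : exhausted _ = set0)%classic;
    first exact: finite_set0.
  by apply/seteqP; split=> // j [_ f0];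
    have [f []] := simple_embeds_regular_neq0 j; apply: f0.
(* A summand isomorphic to some [E j] is split off the image of [e]. The complementary idempotent is
   the first component; the projection to [E j] followed by a nonzero map to [E i0] is the
   second. *)
have step (e : {e | good e}) : exists q : {e | good e} * comodule_hom R (E i0),
    [/\ forall x, sval e (sval q.1 x) = sval q.1 x,
        forall x, q.2 (sval q.1 x) = 0 & exists x, q.2 (sval e x) != 0].
  case: e => e [ee efin] /=.
  have [j [Jj nexh]] : (J `\` exhausted e !=set0)%classic.
    by apply/infinite_setN0; apply: infinite_setD.
  have [f [ef f0]] : exists f :
    comodule_hom (S j) R, (forall x, e (f x) = f x) /\ f <> 0.
    apply: contrapT => nf; apply: nexh; split=> // f ef; apply: contrapT => f0.
    by apply: nf; exists f.
  have [g0 g0E] : exists g0 :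
    comodule_hom (E j) R, forall x, g0 (iota j x) = f x.
    exact: (@regular_injective _ C _ _ (iota j) (hE j).2.1 f).
  have [r0 r0E] : exists r : comodule_hom R (E j), forall y, r (e (g0 y)) = y.
    apply: (hull_split (g := comodule_comp e g0)) => eg0; apply: f0.
    apply: hom_eq0 => x; rewrite -ef -g0E.
    exact: (congr1 (fun h : comodule_hom (S j) R => h x) eg0).
  have [th th0] : exists th : comodule_hom (E j) (E i0), th <> 0.
    by apply: contrapT => nth; apply: Jj => th; apply: contrapT => th0;
      apply: nth; exists th.
  have [g gE] : exists g : comodule_hom (E j) R, forall y, g y = e (g0 y).
    by exists (comodule_comp e g0).
  have [r rE] : exists r : comodule_hom R (E j), forall x, r x = r0 (e x).
    by exists (comodule_comp r0 e).
  have [e' e'E] : exists e' : comodule_hom R R, forall x, e' x = e x - g (r x).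
    by exists (e - comodule_comp g r).
  have eg y : e (g y) = g y by rewrite gE ee.
  have rg y : r (g y) = y by rewrite rE eg gE r0E.
  have re x : r (e x) = r x by rewrite !rE ee.
  have re' x : r (e' x) = 0 by rewrite e'E raddfB /= re rg subrr.
  have ee' x : e (e' x) = e' x by rewrite e'E raddfB /= ee eg.
  have good' : good e'.
    split=> [x|]; first by rewrite [LHS]e'E re' raddf0 subr0 ee'.
    apply: (@sub_finite_set _ _ (exhausted e `|` [set j])%classic); last first.
      by rewrite finite_setU; split=> //; apply: finite_set1.
    move=> l [Jl l0]; have [->|jl] := pselect (l = j); first by right.
    (* For [l] other than [j], a copy of [S l] fixed by [e] maps to zero in [E j], so it is fixed by
       [e'] as well. *)
    left; split=> // h eh; apply: l0 => x; rewrite e'E eh.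
    have -> : r (h x) = 0; last by rewrite raddf0 subr0.
    by rewrite -[LHS]/(comodule_comp r h x)
      (hom_hull_distinct (comodule_comp r h) jl).
  have [y thy] := hom_neq0 th0.
  exists (exist _ e' good', comodule_comp th r); split=> //= [x|].
    by rewrite -[LHS]/(th (r (e' x))) re' raddf0.
  by exists (g y); rewrite /= eg rg.
have /choice[nxt nxtP] := step.
pose e n := iter n (fun u => (nxt u).1) (exist _ _ good1).
pose psi n := (nxt (e n)).2.
have psi_e m n x : (m < n)%N -> psi m (sval (e n) x) = 0.
  move=> mn; have [_ psi0 _] := nxtP (e m).
  suff <- : sval (e m.+1) (sval (e n) x) = sval (e n) x by apply: psi0.
  have idem l y : sval (e l) (sval (e l) y) = sval (e l) y := (svalP (e l)).1 y.
  elim: n mn x => // n IHn; rewrite ltnS leq_eqVlt => /orP[/eqP -> x|mn x].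
    exact: idem.
  have [ee _ _] := nxtP (e n).
  by rewrite -[in LHS](ee x) IHn // ee.
have [s sP] := quasi_finite_at_subfamily (S_simple i0) (hE i0) psi Cfd.
(* With [n] beyond all indices in [s], the maps of [s] vanish on the image of the [n]-th idempotent
   while [psi n] does not. *)
pose n := (\max_(m <- s) m).+1.
have [_ _ [x xn]] := nxtP (e n).
have : psi n (sval (e n) x) = 0; last by move=> psi0;
  rewrite -/(psi n) psi0 eqxx in xn.
apply: sP; apply/allP => m ms; apply/eqP/psi_e.
by rewrite ltnS; apply: (@leq_bigmax_seq _ s xpredT id).
Qed.

End Hulls.

(** * Localization *)

Section PreadditiveTheory.
Context (D : preadditive).
Implicit Types A B X Y : D.

Lemma comp0m A B X (f : hom A B) : (0 : hom B X) ∘m f = 0.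
Proof. by apply: (addrI (0 ∘m f)); rewrite -compDl !addr0. Qed.

Lemma compm0 A B X (g : hom B X) : g ∘m (0 : hom A B) = 0.
Proof. by apply: (addrI (g ∘m 0)); rewrite -compDr !addr0. Qed.

Lemma kernel_monic X A B (i : hom X A) (f : hom A B) : is_kernel i f -> monic i.
Proof.
move=> [fi0 univ] Y g h gh.
have [|u [_ u_uniq]] := univ Y (i ∘m g); first by rewrite compmA fi0 comp0m.
by rewrite -(u_uniq g) // -(u_uniq h).
Qed.

Lemma cokernel_epic A B X (p : hom B X) (f : hom A B) :
  is_cokernel p f -> epic p.
Proof.
move=> [pf0 univ] Y g h gh.
have [|u [_ u_uniq]] := univ Y (g ∘m p); first by rewrite -compmA pf0 compm0.
by rewrite -(u_uniq g) // -(u_uniq h).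
Qed.

Lemma zero_object_idm X : idm X = 0 -> zero_object X.
Proof.
move=> id0 Y; split=> f; first by rewrite -[f]compm1 id0 compm0.
by rewrite -[f]comp1m id0 comp0m.
Qed.

End PreadditiveTheory.

(** * Exactness and monomorphisms of comodules in terms of elements *)

Section ComoduleExactness.
Context (k : fieldType) (C : coalgebra k).
Implicit Types M N X Y Z : comodule C.

Lemma comodule_short_exact X Y Z (i : comodule_hom X Y) (p : comodule_hom Y Z) :
  injective i -> (forall z, exists y, z = p y) ->
  (forall y, p y = 0 <-> exists x, y = i x) ->
  @short_exact (comodule_category C) X Y Z i p.
Proof.
move=> i_inj p_surj exact_ip.
have pi0 : comodule_comp p i = 0.
  by apply: hom_eq0 => x; apply/exact_ip; exists x.
split; split=> [|W g]; first exact: pi0; last first.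
- move=> gi0; have [|h hE] := hom_lift_surj (f :=
  (g : comodule_hom Y W)) p_surj.
    move=> y /exact_ip[x ->].
    exact: (congr1 (fun u : comodule_hom X W => u x) gi0).
  exists h; split=> [|h' h'E]; first exact: comodule_hom_ext.
  apply: comodule_hom_ext => z; have [y ->] := p_surj z.
  by rewrite hE -h'E.
- exact: pi0.
move=> pg0; have [|h hE] := hom_lift_inj (f := (g : comodule_hom W Y)) i_inj.
  move=> w; apply/exact_ip.
  exact: (congr1 (fun u : comodule_hom W Z => u w) pg0).
exists h; split=> [|h' h'E]; first exact: comodule_hom_ext.
by apply: comodule_hom_ext => w; apply: i_inj; rewrite hE -h'E.
Qed.

Lemma sub_short_exact M (N : subcomodule M) :
  @short_exact (comodule_category C) _ _ _ (sub_incl N) (quot_proj N).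
Proof.
apply: comodule_short_exact => [|q|m];
  [exact: sub_incl_inj|exact: quot_proj_surj|].
split=> [/quot_proj_eq0|[x ->]]; first exact: sub_incl_ex.
by apply/quot_proj_eq0/sub_incl_in.
Qed.

Lemma range_short_exact X M (i : comodule_hom X M) : injective i ->
  @short_exact (comodule_category C) _ _ _ i
    (quot_proj (subcomod_of (range_subcomod i))).
Proof.
move=> i_inj; apply: comodule_short_exact => [//|q|m];
  first exact: quot_proj_surj.
by rewrite quot_proj_eq0 subcomod_ofP.
Qed.

Lemma monic_injective M N (f : comodule_hom M N) :
  @monic (comodule_category C) M N f -> injective f.
Proof.
move=> f_monic; apply: raddf_inj => m fm.
pose K := subcomod_of (ker_subcomod f).
have [|x ->] := @sub_incl_ex _ _ _ K m; first exact/subcomod_ofP.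
have incl0 : sub_incl K = 0 :> comodule_hom (sub_comodule K) M.
  apply: (f_monic (sub_comodule K) (sub_incl K) 0); rewrite compm0.
  by apply: hom_eq0 => y; have /subcomod_ofP := sub_incl_in y.
by rewrite incl0.
Qed.

End ComoduleExactness.

(** * Artinian objects in the localization at the hull of a simple comodule *)

Section Localization.
Context (k : fieldType) (C : coalgebra k) (S E : comodule C).
Context (iota : comodule_hom S E) (S_simple : simple S)
    (hull : injective_hull iota).
Context (T : @localization (comodule_category C) (torsion E)).
Implicit Types M N X Y Z : comodule C.

Let E_inj : injective_comodule E := hull.1.

Lemma loc0 M N : fmap T (0 : @hom (comodule_category C) M N) = 0.
Proof.
have [TD _] := loc_exact T.
by apply: (addrI (fmap T 0)); rewrite -TD !addr0.
Qed.

Lemma loc_comp0 M N X (q : comodule_hom N X) (f : comodule_hom M N) :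
  (forall x, q (f x) = 0) ->
  fmap T (q : @hom (comodule_category C) N X) ∘m
    fmap T (f : @hom (comodule_category C) M N) = 0.
Proof.
move=> qf; rewrite -fmap_comp -(loc0 M X); congr (fmap T _).
exact: comodule_hom_ext.
Qed.

(** Maps from the image of [f] to [E] extend to [N], so the hypothesis makes this image torsion;
    [fmap T f] then factors through a zero object. *)
Lemma loc_torsion_map0 M N (f : comodule_hom M N) :
  (forall psi : comodule_hom N E, comodule_comp psi f = 0) ->
  fmap T (f : @hom (comodule_category C) M N) = 0.
Proof.
move=> f0; pose B := subcomod_of (range_subcomod f).
have [|f' f'E] := @hom_lift_inj _ _ _ _ _ (sub_incl B) f
  (@sub_incl_inj _ _ _ B).
  by move=> x; apply/sub_incl_ex/subcomod_ofP; exists x.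
have tB : torsion E (sub_comodule B).
  move=> th; have [psi psiE] := E_inj (@sub_incl_inj _ _ _ B) th.
  apply: hom_eq0 => b; have /subcomod_ofP[x bx] := sub_incl_in b.
  rewrite -psiE bx.
  exact: (congr1 (fun u : comodule_hom M E => u x) (f0 psi)).
have -> : f = comodule_comp (sub_incl B) f' by apply: comodule_hom_ext => x;
  rewrite /= f'E.
have := @fmap_comp _ _ T _ _ _ (sub_incl B) f'; rewrite /= => ->.
have [_ /(_ (fmap T f')) ->] := (loc_kernel T (sub_comodule B)).2 tB (T M).
exact: compm0.
Qed.

(** By exactness [fmap T q] is a cokernel, hence epic; an epic zero map has a zero target. *)
Lemma loc_surjective0 M N (q : comodule_hom M N) :
  (forall y, exists x, y = q x) ->
  fmap T (q : @hom (comodule_category C) M N) = 0 -> torsion E N.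
Proof.
move=> q_surj Tq0; apply/(loc_kernel T)/zero_object_idm.
pose K := subcomod_of (ker_subcomod q).
have Kq : @short_exact (comodule_category C) _ _ _ (sub_incl K) q.
  apply: comodule_short_exact => // [|y]; first exact: sub_incl_inj.
  split=> [qy|[x ->]]; first by apply: sub_incl_ex; apply/subcomod_ofP.
  by have /subcomod_ofP := sub_incl_in x.
have [_ /cokernel_epic Tq_epic] := (loc_exact T).2 _ _ _ _ _ Kq.
by apply: Tq_epic; rewrite Tq0 !compm0.
Qed.

Lemma artinian_quasi_finite_at M : artinian (T M) -> quasi_finite_at S M.
Proof.
move=> Tart N; apply: contrapT => Nfd; set X := quotient_comodule N in Nfd *.
(* Otherwise the maps in [s] would embed Com(S, X) into finitely many copies of the
   finite-dimensional Com(S, E). *)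
have next (s : seq (comodule_hom X E)) : exists psi : comodule_hom X E,
    exists2 x, all (fun f : comodule_hom X E => f x == 0) s & psi x != 0.
  apply: contrapT => ns; apply: Nfd.
  apply: (finite_dimensional_family (f := fun f => @hom_post _ _ S _ _ f) (s :=
    s)
            (finite_dimensional_hom_hull S_simple hull)) => v vs.
  apply: contrapT => /(hull_extend_neq0 S_simple hull)[psi [y psiy]].
  apply: ns; exists psi, (v y) => //.
  apply: sub_all vs => f /eqP fv.
  by rewrite -[f _]/(hom_post f v y) fv.
have /choice[nxt nxtP] := next.
pose L n := iter n (fun s => nxt s :: s) [::].
(* Preimages in [M] of the successive partial common kernels; [T] turns them into a descending chain
   of subobjects. *)
pose Q n := subcomod_of (all_ker_subcomod
  (fun f : comodule_hom X E => comodule_comp f (quot_proj N)) (L n)).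
pose inc n : @hom (comodule_category C) (sub_comodule (Q n)) M :=
  sub_incl (Q n).
have inc_monic n : monic (fmap T (inc n)).
  exact: (kernel_monic ((loc_exact T).2 _ _ _ _ _ (sub_short_exact (Q n))).1).
have stepj n : exists j :
  comodule_hom (sub_comodule (Q n.+1)) (sub_comodule (Q n)),
    forall x, sub_incl (Q n) (j x) = sub_incl (Q n.+1) x.
  apply: hom_lift_inj; first exact: sub_incl_inj.
  move=> x; apply/sub_incl_ex/subcomod_ofP.
  by have /subcomod_ofP /= /andP[] := sub_incl_in x.
have jT n (j : comodule_hom (sub_comodule (Q n.+1)) (sub_comodule (Q n))) :
    (forall x, sub_incl (Q n) (j x) = sub_incl (Q n.+1) x) ->
    fmap T (inc n) ∘m fmap T
      (j : @hom (comodule_category C) _ _) = fmap T (inc n.+1).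
  by move=> jE; rewrite -fmap_comp; congr (fmap T _); apply: comodule_hom_ext.
have [|n /(_ n (leqnn n))[t tE]] := Tart _ (fun n => fmap T (inc n)) inc_monic.
  by move=> n; have [j jE] := stepj n;
    exists (fmap T (j : @hom (comodule_category C) _ _)); apply: jT.
have [j jE] := stepj n.
(* Where the chain becomes stationary, [fmap T j] is split epic, so the quotient of [Q n] by
   [Q n.+1] is torsion. *)
have jt : fmap T (j : @hom (comodule_category C) _ _) ∘m t = idm _.
  by apply: (inc_monic n); rewrite compmA jT // tE compm1.
pose P := subcomod_of (range_subcomod j).
have tP : torsion E (quotient_comodule P).
  apply: (loc_surjective0 (@quot_proj_surj _ _ _ P)).
  rewrite -[LHS]compm1 -jt compmA loc_comp0 ?comp0m // => x.
  by apply/quot_proj_eq0/subcomod_ofP; exists x.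
(* The map added at stage [n] kills [Q n.+1] but not [Q n], so it induces a nonzero map from a
   torsion comodule to [E]. *)
pose chi := comodule_comp (nxt (L n))
  (comodule_comp (quot_proj N) (sub_incl (Q n))).
have [|chi' chi'E] := hom_lift_surj (f := chi) (@quot_proj_surj _ _ _ P).
  move=> x /quot_proj_eq0/subcomod_ofP[y ->].
  rewrite /chi /= jE; have /subcomod_ofP /= := sub_incl_in y.
  by move=> /andP[/eqP].
have [x xs] := nxtP (L n); have [m xm] := quot_proj_surj x.
have [|y yE] := @sub_incl_ex _ _ _ (Q n) m.
  by apply/subcomod_ofP; rewrite xm in xs.
by rewrite xm yE -[nxt _ _]/(chi y) -chi'E (torsion_eq0 chi' _ tP) eqxx.
Qed.

Let G := loc_section T.
Let adj := loc_adjunction T.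

(** The triangle identity makes the localized unit the inverse of the invertible counit; this side
    shows that it is split epic. *)
Lemma section_unit_iso M :
  fmap T (adj_unit adj M) ∘m adj_counit adj (T M) = idm _.
Proof.
have [e eE Ee] := loc_counit_iso (T M).
have <- : e = fmap T (adj_unit adj M).
  by rewrite -[e]compm1 -(adj_triangleF adj M) compmA eE comp1m.
exact: eE.
Qed.

(** The cokernel of the unit becomes zero under [T], so G(T M) is an extension of a torsion comodule
    by a quotient of [M]. *)
Lemma section_quasi_finite_at M :
  quasi_finite_at S M -> quasi_finite_at S (G (T M)).
Proof.
move=> Mfd; pose eta : comodule_hom M (G (T M)) := adj_unit adj M.
pose P := subcomod_of (range_subcomod eta).
apply: ((serre_quasi_finite_at S).2 _ _ _ eta (quot_proj P)) => //.
  by move=> b /quot_proj_eq0/subcomod_ofP.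
apply: (torsion_quasi_finite_at S_simple hull).
apply: (loc_surjective0 (@quot_proj_surj _ _ _ P)).
rewrite -[LHS]compm1 -section_unit_iso compmA.
have -> :
    fmap T (quot_proj P : hom (G (T M)) _) ∘m fmap T (adj_unit adj M) = 0.
  apply: (loc_comp0 (f := eta)) => x.
  by apply/quot_proj_eq0/subcomod_ofP; exists x.
exact: comp0m.
Qed.

(** Right adjoints preserve monomorphisms: each map into [G A] is recovered from its transpose. *)
Lemma section_monic (A B : loc_category T) (u : hom A B) :
  monic u -> monic (fmap G u).
Proof.
move=> u_monic W a b ab.
have transpose (c : hom W (G A)) :
    c = fmap G (adj_counit adj A ∘m fmap T c) ∘m adj_unit adj W.
  rewrite fmap_comp -compmA -adj_unit_natural compmA adj_triangleG comp1m.
  by [].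
rewrite (transpose a) (transpose b); congr (fmap G _ ∘m _); apply: u_monic.
by rewrite !compmA -!adj_counit_natural -!compmA -!fmap_comp ab.
Qed.

(** The section carries the chain to subcomodules of G(T M), where finitely many maps to [E] have
    the same common kernel as a whole sequence adapted to the chain. *)
Lemma quasi_finite_at_artinian M : quasi_finite_at S M -> artinian (T M).
Proof.
move=> /section_quasi_finite_at Xfd U u u_monic u_desc.
set X : comodule C := G (T M) in Xfd.
pose g n : comodule_hom (G (U n)) X := fmap G (u n).
have g_inj n : injective (g n).
  by apply: monic_injective; apply: section_monic.
have g_desc n m : (n <= m)%N -> forall y, exists x, g m y = g n x.
  elim: m => [|m IHm]; first by rewrite leqn0 => /eqP -> y; exists y.
  rewrite leq_eqVlt => /orP[/eqP -> y|]; first by exists y.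
  move=> /IHm{}IHm y; have [t tE] := u_desc m.
  have [x xE] := IHm ((fmap G t : comodule_hom (G (U m.+1)) (G (U m))) y).
  exists x; rewrite -xE.
  have := fmap_comp G (u m) t; rewrite tE => Gt.
  exact: (congr1 (fun h : comodule_hom (G (U m.+1)) X => h y) Gt).
pose vanishes (psi : comodule_hom X E) n := forall y, psi (g n y) = 0.
(* [psi n] kills stage [n.+1] but not stage [n] whenever some map does so; otherwise it is 0. *)
have /choice[psi psiP] n : exists psi : comodule_hom X E, vanishes psi n.+1 /\
    (vanishes psi n -> forall psi', vanishes psi' n.+1 -> vanishes psi' n).
  have [all_van|] := pselect (forall psi', vanishes psi' n.+1 ->
    vanishes psi' n).
    by exists 0.
  move=> /existsNP[psi /not_implyP[van nvan]]; by exists psi.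
have [s sP] := quasi_finite_at_subfamily S_simple hull psi Xfd.
exists (\max_(m <- s) m).+1 => n sn.
(* Since [n] exceeds all indices in [s], the maps of [s] vanish on stage [n]; hence so does
   [psi n]. *)
have van psi' : vanishes psi' n.+1 -> vanishes psi' n.
  apply: (psiP n).2 => y; apply: sP; apply/allP => m ms.
  have [|x ->] := @g_desc m.+1 n _ y; last by rewrite (psiP m).1.
  by apply: leq_trans sn; rewrite ltnS; apply: (@leq_bigmax_seq _ s xpredT id).
pose q := quot_proj (subcomod_of (range_subcomod (g n.+1))).
(* Maps to [E] from the quotient by stage [n.+1] vanish on stage [n], so [loc_torsion_map0] applies
   to the composite. *)
have Tqg : fmap T
  (q : @hom (comodule_category C) _ _) ∘m fmap T (fmap G (u n)) = 0.
  rewrite -fmap_comp; apply: loc_torsion_map0 => th; apply: hom_eq0 => y.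
  apply: (van (comodule_comp th q)) => z.
  rewrite /= (_ : q _ = 0) ?raddf0 //; apply/quot_proj_eq0/subcomod_ofP.
  by exists z.
have [[_ univ] _] := (loc_exact T).2 _ _ _ _ _
  (range_short_exact (@g_inj n.+1)).
have [h [hE _]] := univ _ _ Tqg.
have [e _ Ee] := loc_counit_iso (U n).
(* The factorization [h] after applying section and [T] is carried back to the chain by the counit
   isomorphisms. *)
exists (adj_counit adj (U n.+1) ∘m h ∘m e).
rewrite !compmA -adj_counit_natural -(compmA _ _ h) hE.
by rewrite adj_counit_natural -compmA Ee compm1.
Qed.

End Localization.

Theorem theorem3p1 (k : fieldType) (C : coalgebra k)
  (I : Type) (S : I -> comodule C) (hS : simple_representatives S)
  (E : I -> comodule C) (iota : forall i : I, comodule_hom (S i) (E i))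
  (hE : forall i : I, injective_hull (iota i))
  (T : forall i : I,
     @localization (comodule_category C) (torsion (E i))) :
  [<-> strictly_quasi_finite (regular_comodule C);
       forall i : I, strictly_quasi_finite (E i) /\
         finite_set [set j : I | ~ zero_object (T i (E j))]%classic;
       forall M : comodule C, quasi_finite M -> strictly_quasi_finite M;
       forall i : I, artinian (T i (regular_comodule C))].
Proof.
have S_simple i : simple (S i) by have [] := hS.
have nonzeroE i : [set j : I | ~ zero_object (T i (E j))]%classic =
    [set j : I | ~ torsion (E i) (E j)]%classic.
  by apply/seteqP; split=> j /= nz Tj; apply: nz; apply/(loc_kernel (T i)).
tfae.
- move=> /(strictly_quasi_finiteP hS) Cfd i; split; last first.
    by rewrite nonzeroE; apply: (nontorsion_hulls_finite hS hE).
  apply/(strictly_quasi_finiteP hS) => j.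
  (* Each hull is a quotient of C and inherits membership in the Serre class. *)
  have [p p_surj] := hull_quotient_regular hS hE i.
  exact: (serre_quot (serre_quasi_finite_at (S j)) p_surj (Cfd j)).
- move=> Efd M Mfd; apply/(strictly_quasi_finiteP hS) => i.
  have [_] := Efd i; rewrite nonzeroE => Jfin.
  apply: (quasi_finite_quasi_finite_at hS hE Jfin) => // [j /contrapT //|j].
  by have [/(strictly_quasi_finiteP hS)] := Efd j.
(* The regular comodule is quasi-finite, so the hypothesis applies to it. *)
- move=> qf i; apply: (quasi_finite_at_artinian (S_simple i) (hE i)).
  exact: ((strictly_quasi_finiteP hS _).1 (qf _ (@regular_quasi_finite k C)) i).
- move=> Tart; apply/(strictly_quasi_finiteP hS) => i.
  exact: (artinian_quasi_finite_at (S_simple i) (hE i) (Tart i)).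
Qed.
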